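(* Let $\xi\geq 0$, $V>0$ and $\kappa$ with $0<\kappa<\frac{16}{3(\xi+1)^2}$ be constants, and consider the initial value problem $$\ddot{x}=-x-\kappa x^3+\frac12\frac{V^2}{(\xi+1-x)^2},\quad t>0,\qquad x(0)=0,\quad \dot{x}(0)=0.$$ The cubic equation $$2\kappa x_0^3-\frac32\kappa(\xi+1)x_0^2+2x_0-(\xi+1)=0$$ has a unique real solution $x_0=x^*_{\mathrm{Dpi}}$, which lies in $(0,\xi+1)$; define $$V^*_{\mathrm{Dpi}}=\sqrt{(\xi+1)\left((\xi+1-x_0)x_0+\frac\kappa2(\xi+1-x_0)x_0^3\right)}.$$ Then: (1) If $V<V^*_{\mathrm{Dpi}}$, the response is periodic: there is a stagnation time $t^*_s>0$ at which the top electrode reaches its maximum displacement $x^*_s$, and it follows the same route back to $x=0$ at $t=2t^*_s$; i.e. the response is a function of period $2t_s^*$ symmetric about $t=t_s^*$. Moreover, if in addition $V<\frac12(\xi+1)^{3/2}$, then $$x_s^*<\frac12(\xi+1)-\frac12\sqrt{(\xi+1)^2-\frac{4V^2}{\xi+1}}.$$ Furthermore, $x^*_s$, as a function of $(\kappa,V)$ (in the range $V<V^*_{\mathrm{Dpi}}$), is smooth, strictly decreasing in $\kappa$ and increasing in $V$. (2) If $V>V^*_{\mathrm{Dpi}}$, there is a finite time $t_c>0$ with $x(t)\to 1$ as $t\to t_c$ (contact of the top electrode with the dielectric layer, or with the bottom electrode if $\xi=0$). (3) If $V=V^*_{\mathrm{Dpi}}$, the top electrode never reaches $x=1$ and $x(t)\to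 x^*_{\mathrm{Dpi}}$ as $t\to\infty$. Moreover, $x^*_{\mathrm{Dpi}}$ and $V^*_{\mathrm{Dpi}}$ depend smoothly on $\kappa$, are strictly increasing in $\kappa$, and converge to $\frac12(\xi+1)$ and $\frac12(\xi+1)^{3/2}$ respectively as $\kappa\to0$.
   Context: This models an undamped parallel-plate electrostatic actuator with a cubically nonlinear elastic force, in normalized units, with Hamiltonian $H=\frac12\dot{x}^2+\frac12x^2+\frac14\kappa x^4-\frac12\frac{V^2}{\xi+1-x}$, where $\kappa=k_3g^2/k>0$ measures the cubic stiffness, $\xi\ge 0$ is the effective normalized thickness of the dielectric coating on the bottom electrode, and $V$ is the normalized applied voltage. $x$ is the displacement of the top electrode; physically meaningful solutions satisfy $0\le x\le 1$, where $x=1$ is the touch-down (contact) position, and the solution is considered only while $x<1$.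
   Formalization: In (3), ''never reaches x=1'' is replaced by x(t)<x*_Dpi for all t, since for ξ≥1 one has x*_Dpi>1 and x(t)→x*_Dpi forces x to pass 1; it still gives x<1 when x*_Dpi≤1. The solution is taken on x<ξ+1, not cut off at x=1. *)

(* Defs.v *)
From Stdlib Require Import Reals.
From Coquelicot Require Import Coquelicot.
Open Scope R_scope.

Definition rhs (kappa xi V x : R) : R :=
  - x - kappa * x ^ 3 + / 2 * V ^ 2 / (xi + 1 - x) ^ 2.

(* x is a solution (response) of the IVP on the time interval [0, T):
   x(0) = 0, x'(0) = 0 (with x, x' right-continuous at 0), the ODE holds on
   (0, T), and x stays in the domain x < xi + 1 of the equation. *)
Definition is_response (kappa xi V : R) (T : Rbar) (x : R -> R) : Prop :=
  exists v : R -> R,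
    x 0 = 0 /\ v 0 = 0 /\
    (forall t, 0 <= t -> Rbar_lt t T -> x t < xi + 1) /\
    (forall t, 0 < t -> Rbar_lt t T ->
        is_derive x t (v t) /\ is_derive v t (rhs kappa xi V (x t))) /\
    filterlim x (at_right 0) (locally 0) /\
    filterlim v (at_right 0) (locally 0).

Definition dpi_cubic (kappa xi x : R) : R :=
  2 * kappa * x ^ 3 - 3 / 2 * kappa * (xi + 1) * x ^ 2 + 2 * x - (xi + 1).

Definition VDpi (xi kappa x0 : R) : R :=
  sqrt ((xi + 1) * ((xi + 1 - x0) * x0 + kappa / 2 * (xi + 1 - x0) * x0 ^ 3)).

Definition smooth1 (U : R -> Prop) (f : R -> R) : Prop :=
  forall (n : nat) (t : R), U t -> ex_derive_n f n t.

Fixpoint C2 (n : nat) (U : R -> R -> Prop) (f : R -> R -> R) : Prop :=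
  match n with
  | O => forall x y, U x y -> continuity_2d_pt f x y
  | S m => exists fx fy : R -> R -> R,
      (forall x y, U x y ->
         is_derive (fun u => f u y) x (fx x y) /\
         is_derive (fun w => f x w) y (fy x y)) /\
      C2 m U fx /\ C2 m U fy
  end.

Definition smooth2 (U : R -> R -> Prop) (f : R -> R -> R) : Prop :=
  forall n, C2 n U f.

(* Main.v *)
Require Import Defs.
From Stdlib Require Import Reals Lra Lia ClassicalEpsilon.
From Coquelicot Require Import Coquelicot.
Open Scope R_scope.

(* Conservation of energy turns the ODE into
     x'^2 = x (V^2 - W x) / ((xi+1) (xi+1-x)),
   W x = (xi+1) ((xi+1-x) x + kappa/2 (xi+1-x) x^3),
   and W' = - (xi+1) * cubic, so that W has its maximum V_Dpi^2 at the unique root x_Dpi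
   of the cubic.  According to whether V^2 - W has a first simple zero X, no zero, or a
   double zero D, the substitution x = X sin^2 th, x = th^2, or x = D tanh^2 th removes the
   degeneracies of the right-hand side: th' = sqrt (h x) with h > 0, so th is the inverse
   of an integral.  The period, the finite contact time and the infinite transit time are
   read off this integral.  Smoothness in the parameters is a bootstrap: the implicit
   derivatives of x_Dpi and X are rational functions of the parameters and of x_Dpi, X. *)

(** * Calculus of smooth functions of two variables *)

(** The energy equation alone does not determine the motion: its right side vanishes at [x = 0],
    where the response starts, so the constant 0 satisfies it too, and integrating [dx / x']
    directly gives improper integrals at 0 and at a turning point. In the new phase the integrand is
    continuous, so ordinary integrals suffice and a turning point is passed without gluing branches.
    The second-order equation is then verified for the function so obtained, and a separate Gronwall
    estimate identifies every other response with it. *)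

Definition open2 (U : R -> R -> Prop) : Prop :=
  forall x y, U x y -> locally_2d U x y.

(** At a positive level [C2] speaks only of partial derivatives. Continuity of [f] comes from total
    differentiability: the [x]-partial exists nearby and is continuous, and the [y]-partial exists
    at the point. *)
Lemma C2_continuous (n : nat) (U : R -> R -> Prop) (f : R -> R -> R) :
  open2 U -> C2 n U f -> forall x y, U x y -> continuity_2d_pt f x y.
Proof.
  intros HU; revert f; induction n as [|n IH]; intros f Hf x y Hxy.
  { exact (Hf x y Hxy). }
  destruct Hf as (fx & fy & Hd & Hx & Hy).
  apply differentiable_continuity_pt.
  exists (fx x y), (fy x y).
  apply filterdiff_differentiable_pt_lim.
  apply (is_derive_filterdiff f x y fx (fy x y)).
  - apply (proj1 (locally_2d_locally
      (fun u v => is_derive (fun z => f z v) u (fx u v)) x y)).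
    destruct (HU x y Hxy) as [d Hdl].
    exists d; intros u v Hu Hv; apply Hd, Hdl; assumption.
  - apply Hd; assumption.
  - apply continuity_2d_pt_filterlim; exact (IH fx Hx x y Hxy).
Qed.

Lemma C2_pred (n : nat) (U : R -> R -> Prop) (f : R -> R -> R) :
  open2 U -> C2 (S n) U f -> C2 n U f.
Proof.
  intros HU; revert f; induction n as [|n IH]; intros f Hf.
  - intros x y; apply (C2_continuous 1 U f HU Hf).
  - destruct Hf as (fx & fy & Hd & Hx & Hy).
    exists fx, fy; split; [exact Hd|]; split; apply IH; assumption.
Qed.

Lemma C2_ext (n : nat) (U : R -> R -> Prop) (f g : R -> R -> R) :
  open2 U -> (forall x y, U x y -> f x y = g x y) -> C2 n U f -> C2 n U g.
Proof.
  intros HU He Hf.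
  assert (HL : forall x y, U x y -> locally_2d (fun u v => f u v = g u v) x y).
  { intros x y Hxy; destruct (HU x y Hxy) as [d Hd]; exists d; intros; apply He, Hd; assumption. }
  destruct n as [|n].
  - intros x y Hxy.
    apply continuity_2d_pt_ext_loc with (2 := Hf x y Hxy); apply HL, Hxy.
  - destruct Hf as (fx & fy & Hd & Hx & Hy).
    exists fx, fy; split; [|split; assumption].
    intros x y Hxy; destruct (Hd x y Hxy) as [D1 D2]; split.
    + apply is_derive_ext_loc with (2 := D1).
      exact (locally_2d_1d_const_y _ _ _ (HL x y Hxy)).
    + apply is_derive_ext_loc with (2 := D2).
      exact (locally_2d_1d_const_x _ _ _ (HL x y Hxy)).
Qed.

Lemma C2_const (n : nat) (U : R -> R -> Prop) (c : R) : C2 n U (fun _ _ => c).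
Proof.
  revert c; induction n as [|n IH]; intros c.
  - intros x y _; apply continuity_2d_pt_const.
  - exists (fun _ _ => 0), (fun _ _ => 0); split; [|split; apply IH].
    intros; split; auto_derive; trivial.
Qed.

Lemma C2_fst (n : nat) (U : R -> R -> Prop) : C2 n U (fun x _ => x).
Proof.
  destruct n as [|n].
  - intros x y _; apply continuity_2d_pt_id1.
  - exists (fun _ _ => 1), (fun _ _ => 0); split; [|split; apply C2_const].
    intros; split; auto_derive; trivial.
Qed.

Lemma C2_snd (n : nat) (U : R -> R -> Prop) : C2 n U (fun _ y => y).
Proof.
  destruct n as [|n].
  - intros x y _; apply continuity_2d_pt_id2.
  - exists (fun _ _ => 0), (fun _ _ => 1); split; [|split; apply C2_const].
    intros; split; auto_derive; trivial.
Qed.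

Lemma C2_plus (n : nat) (U : R -> R -> Prop) (f g : R -> R -> R) :
  C2 n U f -> C2 n U g -> C2 n U (fun x y => f x y + g x y).
Proof.
  revert f g; induction n as [|n IH]; intros f g Hf Hg.
  - intros x y Hxy; apply continuity_2d_pt_plus; [apply Hf|apply Hg]; exact Hxy.
  - destruct Hf as (fx & fy & Hfd & Hfx & Hfy), Hg as (gx & gy & Hgd & Hgx & Hgy).
    exists (fun x y => fx x y + gx x y), (fun x y => fy x y + gy x y).
    split; [|split; apply IH; assumption].
    intros x y Hxy; destruct (Hfd x y Hxy), (Hgd x y Hxy).
    split; apply @is_derive_plus; assumption.
Qed.

Lemma C2_mult (n : nat) (U : R -> R -> Prop) (f g : R -> R -> R) :
  open2 U -> C2 n U f -> C2 n U g -> C2 n U (fun x y => f x y * g x y).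
Proof.
  intros HU; revert f g; induction n as [|n IH]; intros f g Hf Hg.
  - intros x y Hxy; apply continuity_2d_pt_mult; [apply Hf|apply Hg]; exact Hxy.
  - assert (Hf' := C2_pred n U f HU Hf); assert (Hg' := C2_pred n U g HU Hg).
    destruct Hf as (fx & fy & Hfd & Hfx & Hfy), Hg as (gx & gy & Hgd & Hgx & Hgy).
    exists (fun x y => fx x y * g x y + f x y * gx x y),
           (fun x y => fy x y * g x y + f x y * gy x y).
    split; [|split; apply C2_plus; apply IH; assumption].
    intros x y Hxy; destruct (Hfd x y Hxy), (Hgd x y Hxy).
    split.
    + apply (is_derive_mult (fun u => f u y) (fun u => g u y)); trivial; intros; apply Rmult_comm.
    + apply (is_derive_mult (fun w => f x w) (fun w => g x w)); trivial; intros; apply Rmult_comm.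
Qed.

Lemma C2_opp (n : nat) (U : R -> R -> Prop) (f : R -> R -> R) :
  open2 U -> C2 n U f -> C2 n U (fun x y => - f x y).
Proof.
  intros HU Hf.
  apply C2_ext with (fun x y => (-1) * f x y); trivial; [intros; ring|].
  apply C2_mult; trivial; apply C2_const.
Qed.

Lemma C2_minus (n : nat) (U : R -> R -> Prop) (f g : R -> R -> R) :
  open2 U -> C2 n U f -> C2 n U g -> C2 n U (fun x y => f x y - g x y).
Proof. intros; apply C2_plus; trivial; apply C2_opp; trivial. Qed.

Lemma C2_pow (n m : nat) (U : R -> R -> Prop) (f : R -> R -> R) :
  open2 U -> C2 n U f -> C2 n U (fun x y => f x y ^ m).
Proof.
  intros HU Hf; induction m as [|m IH]; simpl; [apply C2_const|apply C2_mult; trivial].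
Qed.

(** The partials of [/ f] are products of those of [f] with [/ f] itself, so the induction
    hypothesis one level lower covers them. The same pattern handles [sqrt]. *)
Lemma C2_inv (n : nat) (U : R -> R -> Prop) (f : R -> R -> R) :
  open2 U -> (forall x y, U x y -> f x y <> 0) -> C2 n U f -> C2 n U (fun x y => / f x y).
Proof.
  intros HU H0; induction n as [|n IH]; intros Hf.
  - intros x y Hxy; apply continuity_2d_pt_inv; [apply Hf|apply H0]; exact Hxy.
  - assert (Hi := IH (C2_pred n U f HU Hf)).
    destruct Hf as (fx & fy & Hfd & Hfx & Hfy).
    exists (fun x y => - (fx x y * (/ f x y * / f x y))),
           (fun x y => - (fy x y * (/ f x y * / f x y))).
    split; [|split; apply C2_opp; trivial; apply C2_mult; trivial; apply C2_mult; trivial].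
    intros x y Hxy; destruct (Hfd x y Hxy) as [D1 D2]; specialize (H0 x y Hxy).
    split.
    + replace (- (fx x y * (/ f x y * / f x y))) with (- fx x y / f x y ^ 2) by (field; exact H0).
      apply (is_derive_inv (fun u => f u y)); trivial.
    + replace (- (fy x y * (/ f x y * / f x y))) with (- fy x y / f x y ^ 2) by (field; exact H0).
      apply (is_derive_inv (fun w => f x w)); trivial.
Qed.

Lemma C2_div (n : nat) (U : R -> R -> Prop) (f g : R -> R -> R) :
  open2 U -> (forall x y, U x y -> g x y <> 0) -> C2 n U f -> C2 n U g ->
  C2 n U (fun x y => f x y / g x y).
Proof. intros; apply C2_mult; trivial; apply C2_inv; trivial. Qed.

Lemma C2_sqrt (n : nat) (U : R -> R -> Prop) (f : R -> R -> R) :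
  open2 U -> (forall x y, U x y -> 0 < f x y) -> C2 n U f -> C2 n U (fun x y => sqrt (f x y)).
Proof.
  intros HU H0; induction n as [|n IH]; intros Hf.
  - intros x y Hxy.
    apply continuity_1d_2d_pt_comp; [apply sqrt_continuity_pt, H0|apply Hf]; exact Hxy.
  - assert (Hi := IH (C2_pred n U f HU Hf)).
    destruct Hf as (fx & fy & Hfd & Hfx & Hfy).
    assert (Hs : forall x y, U x y -> 2 * sqrt (f x y) <> 0).
    { intros x y Hxy; assert (H := sqrt_lt_R0 _ (H0 x y Hxy)); lra. }
    exists (fun x y => fx x y / (2 * sqrt (f x y))), (fun x y => fy x y / (2 * sqrt (f x y))).
    split.
    + intros x y Hxy; destruct (Hfd x y Hxy) as [D1 D2]; specialize (H0 x y Hxy).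
      split; [apply (is_derive_sqrt (fun u => f u y))|apply (is_derive_sqrt (fun w => f x w))]; trivial.
    + split; apply C2_div; trivial; apply C2_mult; trivial; apply C2_const.
Qed.

Lemma smooth2_bootstrap (U : R -> R -> Prop) (z zx zy : R -> R -> R) :
  (forall x y, U x y -> continuity_2d_pt z x y) ->
  (forall x y, U x y -> is_derive (fun u => z u y) x (zx x y) /\
                        is_derive (fun w => z x w) y (zy x y)) ->
  (forall n, C2 n U z -> C2 n U zx /\ C2 n U zy) ->
  smooth2 U z.
Proof.
  intros Hc Hd Hr n; induction n as [|n IH]; [exact Hc|].
  exists zx, zy; split; [exact Hd|exact (Hr n IH)].
Qed.

Lemma C2_ex_derive_n (n : nat) (U : R -> R -> Prop) (f : R -> R -> R) (x y : R) :
  open2 U -> C2 n U f -> U x y -> ex_derive_n (fun u => f u y) n x.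
Proof.
  intros HU; revert f x; induction n as [|n IH]; intros f x Hf Hxy; [exact I|].
  destruct Hf as (fx & fy & Hd & Hx & Hy).
  destruct n as [|n].
  - exists (fx x y); apply Hd, Hxy.
  - assert (IH' := IH fx x Hx Hxy).
    change (ex_derive (Derive_n (fun u => fx u y) n) x) in IH'.
    change (ex_derive (Derive_n (fun u => f u y) (S n)) x).
    apply ex_derive_ext_loc with (2 := IH').
    assert (HL := locally_2d_1d_const_y _ _ _ (HU x y Hxy)).
    apply locally_locally in HL.
    apply filter_imp with (2 := HL); intros t Ht.
    (* [Derive_n] adds new derivatives on the outside, whereas [C2] peels off the innermost one;
       composing orders [n] and 1 exchanges the two. *)
    replace (S n) with (n + 1)%nat by lia.
    rewrite <- Derive_n_comp; apply Derive_n_ext_loc.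
    apply filter_imp with (2 := Ht); intros s Hs; symmetry.
    apply is_derive_unique, Hd, Hs.
Qed.

(** * Slopes, continuity and implicit differentiation in one variable *)

Lemma slope_derive (f s : R -> R) (t0 : R) :
  locally t0 (fun t => f t - f t0 = (t - t0) * s t) -> continuity_pt s t0 ->
  is_derive f t0 (s t0).
Proof.
  intros [d Hd] Hs; apply is_derive_Reals; intros eps Heps.
  destruct (Hs eps Heps) as [e [He Hse]].
  assert (Hm : 0 < Rmin d e) by (apply Rmin_pos; [apply cond_pos|exact He]).
  exists (mkposreal _ Hm); intros h Hh0 Hh; simpl in Hh.
  assert (H1 : Rabs h < d) by (apply Rlt_le_trans with (1 := Hh), Rmin_l).
  assert (H2 : Rabs h < e) by (apply Rlt_le_trans with (1 := Hh), Rmin_r).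
  rewrite Hd.
  - replace ((t0 + h - t0) * s (t0 + h) / h - s t0) with (s (t0 + h) - s t0) by (field; exact Hh0).
    apply Hse; split; [split; [exact I|intros E; lra]|].
    simpl; unfold Rdist; replace (t0 + h - t0) with h by ring; exact H2.
  - unfold ball; simpl; unfold AbsRing_ball, abs, minus, plus, opp; simpl.
    replace (t0 + h + - t0) with h by ring; exact H1.
Qed.

(** Caratheodory's form of differentiability, converse to [slope_derive]. It reduces the
    differentiation of implicit and inverse functions to algebra with slopes. *)
Lemma derive_slope (f : R -> R) (t0 l : R) :
  is_derive f t0 l ->
  exists s, (forall t, f t - f t0 = (t - t0) * s t) /\ continuity_pt s t0 /\ s t0 = l.
Proof.
  intros Hf; apply is_derive_Reals in Hf.
  pose (s t := if Req_EM_T t t0 then l else (f t - f t0) / (t - t0)).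
  assert (E0 : s t0 = l) by (unfold s; destruct (Req_EM_T t0 t0); congruence).
  exists s; split; [|split; [|exact E0]].
  - intros t; unfold s; destruct (Req_EM_T t t0) as [->|H]; [ring|field; lra].
  - intros eps Heps; destruct (Hf eps Heps) as [d Hd].
    exists d; split; [apply cond_pos|]; intros t [[_ Ht0] Ht].
    change (Rabs (s t - s t0) < eps); change (Rabs (t - t0) < d) in Ht.
    rewrite E0; unfold s; destruct (Req_EM_T t t0) as [->|H]; [congruence|].
    assert (K := Hd (t - t0) ltac:(lra) Ht).
    rewrite (Rplus_minus t0 t) in K; exact K.
Qed.

Lemma cpt_const (c t : R) : continuity_pt (fun _ => c) t.
Proof. intros; apply continuity_pt_const; intros u v; reflexivity. Qed.

Lemma cpt_plus (f g : R -> R) (t : R) :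
  continuity_pt f t -> continuity_pt g t -> continuity_pt (fun u => f u + g u) t.
Proof. exact (continuity_pt_plus f g t). Qed.

Lemma cpt_minus (f g : R -> R) (t : R) :
  continuity_pt f t -> continuity_pt g t -> continuity_pt (fun u => f u - g u) t.
Proof. exact (continuity_pt_minus f g t). Qed.

Lemma cpt_opp (f : R -> R) (t : R) :
  continuity_pt f t -> continuity_pt (fun u => - f u) t.
Proof. exact (continuity_pt_opp f t). Qed.

Lemma cpt_mult (f g : R -> R) (t : R) :
  continuity_pt f t -> continuity_pt g t -> continuity_pt (fun u => f u * g u) t.
Proof. exact (continuity_pt_mult f g t). Qed.

Lemma cpt_inv (f : R -> R) (t : R) :
  continuity_pt f t -> f t <> 0 -> continuity_pt (fun u => / f u) t.
Proof. exact (continuity_pt_inv f t). Qed.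

Lemma cpt_pow (f : R -> R) (n : nat) (t : R) :
  continuity_pt f t -> continuity_pt (fun u => f u ^ n) t.
Proof.
  intros Hf; induction n as [|n IH]; simpl; [apply cpt_const|apply cpt_mult; trivial].
Qed.

Lemma cpt_comp (f g : R -> R) (t : R) :
  continuity_pt g (f t) -> continuity_pt f t -> continuity_pt (fun u => g (f u)) t.
Proof. intros Hg Hf; exact (continuity_pt_comp f g t Hf Hg). Qed.

Ltac cont :=
  repeat first [ assumption | apply cpt_const | apply continuity_pt_id
               | apply cpt_plus | apply cpt_minus | apply cpt_opp | apply cpt_inv
               | apply cpt_pow | apply cpt_mult ].

Ltac cont2 :=
  repeat first [ assumption | apply continuity_2d_pt_const | apply continuity_2d_pt_id1
               | apply continuity_2d_pt_id2 | apply continuity_2d_pt_plus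
               | apply continuity_2d_pt_minus | apply continuity_2d_pt_opp
               | apply continuity_2d_pt_mult ].

Ltac smooth :=
  repeat first [ assumption | apply C2_const | apply C2_fst | apply C2_snd
               | apply C2_plus | apply C2_minus | apply C2_opp | apply C2_pow
               | apply C2_mult ].

Lemma cpt_locally (f : R -> R) (t : R) (P : R -> Prop) :
  continuity_pt f t -> locally (f t) P -> locally t (fun u => P (f u)).
Proof. intros Hf HP; apply continuity_pt_filterlim in Hf; exact (Hf P HP). Qed.

Lemma c2d_locally_lt (f : R -> R -> R) (x y c : R) :
  continuity_2d_pt f x y -> f x y < c -> locally_2d (fun u v => f u v < c) x y.
Proof.
  intros Hf Hlt; assert (H : 0 < c - f x y) by lra.
  destruct (Hf (mkposreal _ H)) as [d Hd]; exists d; intros u v Hu Hv.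
  specialize (Hd u v Hu Hv); simpl in Hd; apply Rabs_def2 in Hd; lra.
Qed.

Lemma locally_neq0 (y : R) : y <> 0 -> locally y (fun u => u <> 0).
Proof.
  intros Hy; assert (H : 0 < Rabs y) by (apply Rabs_pos_lt; exact Hy).
  exists (mkposreal _ H); intros u Hu ->.
  change (Rabs (0 - y) < Rabs y) in Hu; rewrite Rminus_0_l, Rabs_Ropp in Hu; lra.
Qed.

(** If [z] is defined by an equation polynomial in [t] and [z], subtracting its instances at [t] and
    [t0] yields exactly such an identity, with [A t0] the partial derivative in [z]. Continuity of
    [z], proved beforehand, makes [A] continuous. *)
Lemma implicit_derive (z A B : R -> R) (t0 : R) :
  continuity_pt A t0 -> continuity_pt B t0 -> A t0 <> 0 ->
  locally t0 (fun t => (z t - z t0) * A t = (t - t0) * B t) ->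
  is_derive z t0 (B t0 / A t0).
Proof.
  intros HA HB H0 HL.
  apply (slope_derive z (fun t => B t / A t)).
  - assert (HN := cpt_locally A t0 _ HA (locally_neq0 _ H0)).
    generalize (filter_and _ _ HL HN); apply filter_imp; intros t [E N].
    replace (z t - z t0) with ((z t - z t0) * A t / A t) by (field; exact N).
    rewrite E; field; exact N.
  - apply (cpt_mult B (fun t => / A t)); [exact HB|apply cpt_inv; assumption].
Qed.

(** * The equilibrium cubic *)

(** For [k > 0] the upper bound says that the derivative [6 k x^2 - 3 k (xi + 1) x + 2] of the cubic
    has negative discriminant. *)
Definition krange (xi k : R) : Prop := 0 < k < 16 / (3 * (xi + 1) ^ 2).

Lemma krange_bound (xi k : R) : 0 <= xi -> krange xi k -> 3 * k * (xi + 1) ^ 2 < 16.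
Proof.
  intros Hxi [_ H].
  assert (P : 0 < 3 * (xi + 1) ^ 2) by (assert (0 < (xi + 1) ^ 2) by (apply pow_lt; lra); lra).
  apply (Rmult_lt_compat_r _ _ _ P) in H.
  replace (16 / (3 * (xi + 1) ^ 2) * (3 * (xi + 1) ^ 2)) with 16 in H by (field; lra).
  lra.
Qed.

(** Divided difference of the cubic, as a polynomial that also makes sense at [x = y], where it is
    the derivative. Its positivity thus gives both strict monotonicity and a nonzero denominator in
    implicit derivatives. *)
Definition cslope (xi k x y : R) : R :=
  2 * k * (x ^ 2 + x * y + y ^ 2) - 3 / 2 * k * (xi + 1) * (x + y) + 2.

Lemma cslope_spec (xi k x y : R) :
  dpi_cubic k xi y - dpi_cubic k xi x = (y - x) * cslope xi k x y.
Proof. unfold dpi_cubic, cslope; field. Qed.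

(** Completing squares in [x + y] and [x - y] leaves a constant that is positive by the bound on
    [k]. *)
Lemma cslope_pos (xi k x y : R) : 0 <= xi -> krange xi k -> 0 < cslope xi k x y.
Proof.
  intros Hxi Hk; assert (H := krange_bound xi k Hxi Hk); destruct Hk as [Hk _].
  replace (cslope xi k x y) with
    (3 / 2 * k * (x + y - (xi + 1) / 2) ^ 2 + / 2 * k * (x - y) ^ 2
     + (16 - 3 * k * (xi + 1) ^ 2) / 8) by (unfold cslope; field).
  assert (0 <= 3 / 2 * k * (x + y - (xi + 1) / 2) ^ 2)
    by (apply Rmult_le_pos; [lra|apply pow2_ge_0]).
  assert (0 <= / 2 * k * (x - y) ^ 2) by (apply Rmult_le_pos; [lra|apply pow2_ge_0]).
  lra.
Qed.

Lemma cubic_lt (xi k x y : R) :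
  0 <= xi -> krange xi k -> x < y -> dpi_cubic k xi x < dpi_cubic k xi y.
Proof.
  intros Hxi Hk Hxy; assert (H := cslope_spec xi k x y).
  assert (P := cslope_pos xi k x y Hxi Hk).
  assert (0 < (y - x) * cslope xi k x y) by (apply Rmult_lt_0_compat; lra).
  lra.
Qed.

(** At this point the terms without [k] cancel and [- k (xi + 1)^3 / 8] remains. *)
Lemma cubic_half (xi k : R) : 0 <= xi -> 0 < k -> dpi_cubic k xi ((xi + 1) / 2) < 0.
Proof.
  intros Hxi Hk; unfold dpi_cubic.
  assert (0 < k * (xi + 1) ^ 3) by (apply Rmult_lt_0_compat; [lra|apply pow_lt; lra]).
  nra.
Qed.

(** The coefficient of [k] in the cubic is [2 x^2 (x - 3 (xi + 1) / 4)], which vanishes here. That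
    the root lies to the left of this point later fixes the sign of this coefficient. *)
Lemma cubic_three_quarters (xi k : R) : 0 <= xi -> 0 < dpi_cubic k xi (3 * (xi + 1) / 4).
Proof.
  intros Hxi.
  replace (dpi_cubic k xi (3 * (xi + 1) / 4)) with ((xi + 1) / 2) by (unfold dpi_cubic; field).
  lra.
Qed.

Lemma cubic_root (xi k : R) : 0 <= xi -> krange xi k -> exists x, dpi_cubic k xi x = 0.
Proof.
  intros Hxi Hk.
  destruct (IVT_gen (dpi_cubic k xi) ((xi + 1) / 2) (3 * (xi + 1) / 4) 0) as [x [_ Hx]].
  - intros x; unfold dpi_cubic; cont.
  - assert (H1 := cubic_half xi k Hxi (proj1 Hk)).
    assert (H2 := cubic_three_quarters xi k Hxi).
    rewrite Rmin_left, Rmax_right; lra.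
  - exists x; exact Hx.
Qed.

Definition xDpi (xi k : R) : R := epsilon (inhabits 0) (fun x => dpi_cubic k xi x = 0).

Lemma xDpi_root (xi k : R) : 0 <= xi -> krange xi k -> dpi_cubic k xi (xDpi xi k) = 0.
Proof.
  intros Hxi Hk; apply (epsilon_spec (inhabits 0) (fun x => dpi_cubic k xi x = 0)).
  apply cubic_root; assumption.
Qed.

(** This turns every comparison with the chosen root into an evaluation of the cubic; bounds,
    monotonicity and continuity of [xDpi] all go through it. *)
Lemma cubic_sign (xi k x : R) : 0 <= xi -> krange xi k ->
  (dpi_cubic k xi x < 0 <-> x < xDpi xi k) /\ (0 < dpi_cubic k xi x <-> xDpi xi k < x).
Proof.
  intros Hxi Hk; assert (H := xDpi_root xi k Hxi Hk).
  assert (L := fun x y => cubic_lt xi k x y Hxi Hk).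
  destruct (Rtotal_order x (xDpi xi k)) as [C|[C|C]].
  - specialize (L _ _ C); lra.
  - rewrite C, H; lra.
  - specialize (L _ _ C); lra.
Qed.

Lemma xDpi_unique (xi k x : R) : 0 <= xi -> krange xi k ->
  dpi_cubic k xi x = 0 <-> x = xDpi xi k.
Proof.
  intros Hxi Hk; destruct (cubic_sign xi k x Hxi Hk) as [A B].
  split; [lra|intros ->; apply xDpi_root; assumption].
Qed.

Lemma xDpi_bounds (xi k : R) : 0 <= xi -> krange xi k ->
  (xi + 1) / 2 < xDpi xi k < 3 * (xi + 1) / 4.
Proof.
  intros Hxi Hk; split.
  - apply (cubic_sign xi k _ Hxi Hk), cubic_half; [exact Hxi|exact (proj1 Hk)].
  - apply (cubic_sign xi k _ Hxi Hk), cubic_three_quarters; exact Hxi.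
Qed.

(** The coefficient of [k] is negative at the old root, so raising [k] makes the cubic negative
    there and the new root lies further right. *)
Lemma xDpi_increasing (xi k1 k2 : R) : 0 <= xi -> krange xi k1 -> krange xi k2 ->
  k1 < k2 -> xDpi xi k1 < xDpi xi k2.
Proof.
  intros Hxi H1 H2 H12; apply (cubic_sign xi k2 _ Hxi H2).
  assert (E := xDpi_root xi k1 Hxi H1); assert (B := xDpi_bounds xi k1 Hxi H1).
  set (x := xDpi xi k1) in *.
  replace (dpi_cubic k2 xi x) with
    (dpi_cubic k1 xi x - (k2 - k1) * (x ^ 2 * (3 / 2 * (xi + 1) - 2 * x)))
    by (unfold dpi_cubic; field).
  assert (0 < (k2 - k1) * (x ^ 2 * (3 / 2 * (xi + 1) - 2 * x))); [|lra].
  apply Rmult_lt_0_compat; [lra|apply Rmult_lt_0_compat; [apply pow_lt; lra|lra]].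
Qed.

Lemma krange_open (xi : R) : open2 (fun k _ => krange xi k).
Proof.
  intros k y [H1 H2].
  assert (L1 : locally_2d (fun u _ => - u < 0) k y) by (apply c2d_locally_lt; [cont2|lra]).
  assert (L2 : locally_2d (fun u _ => u < 16 / (3 * (xi + 1) ^ 2)) k y)
    by (apply (c2d_locally_lt (fun u _ => u)); [cont2|exact H2]).
  destruct (locally_2d_and _ _ _ _ L1 L2) as [d Hd].
  exists d; intros u v Hu Hv; specialize (Hd u v Hu Hv); cbv beta in Hd; split; lra.
Qed.

(** The signs of the cubic at [z - eps] and [z + eps] are strict, hence persist for nearby
    parameters and trap the root between these points. *)
Lemma xDpi_continuous2 (xi k y : R) : 0 <= xi -> krange xi k ->
  continuity_2d_pt (fun k _ => xDpi xi k) k y.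
Proof.
  intros Hxi Hk eps; set (z := xDpi xi k).
  assert (He := cond_pos eps).
  assert (L1 : locally_2d (fun u _ => dpi_cubic u xi (z - eps) < 0) k y).
  { apply (c2d_locally_lt (fun u _ => dpi_cubic u xi (z - eps))).
    - unfold dpi_cubic; cont2.
    - apply cubic_sign; trivial; unfold z; lra. }
  assert (L2 : locally_2d (fun u _ => - dpi_cubic u xi (z + eps) < 0) k y).
  { apply (c2d_locally_lt (fun u _ => - dpi_cubic u xi (z + eps))).
    - unfold dpi_cubic; cont2.
    - apply Ropp_lt_gt_0_contravar, Rlt_gt, cubic_sign; trivial; unfold z; lra. }
  assert (L := locally_2d_and _ _ _ _ (krange_open xi k y Hk) (locally_2d_and _ _ _ _ L1 L2)).
  destruct L as [d Hd]; exists d; intros u v Hu Hv; destruct (Hd u v Hu Hv) as (K & C1 & C2').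
  apply (cubic_sign xi u _ Hxi K) in C1.
  assert (C3 : 0 < dpi_cubic u xi (z + eps)) by lra.
  apply (cubic_sign xi u _ Hxi K) in C3.
  apply Rabs_def1; lra.
Qed.

Lemma continuity_2d_pt_fst (f : R -> R -> R) (x y : R) :
  continuity_2d_pt f x y -> continuity_pt (fun u => f u y) x.
Proof.
  intros H; apply continuity_pt_filterlim, filterlim_locally; intros eps.
  exact (locally_2d_1d_const_y _ _ _ (H eps)).
Qed.

Lemma continuity_2d_pt_snd (f : R -> R -> R) (x y : R) :
  continuity_2d_pt f x y -> continuity_pt (fun v => f x v) y.
Proof.
  intros H; apply continuity_pt_filterlim, filterlim_locally; intros eps.
  exact (locally_2d_1d_const_x _ _ _ (H eps)).
Qed.

(** The second variable is a dummy, so that one calculus serves both [xDpi] and the stagnation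
    displacement. *)
Lemma xDpi_smooth (xi : R) : 0 <= xi ->
  smooth2 (fun k _ => krange xi k) (fun k _ => xDpi xi k).
Proof.
  intros Hxi.
  apply smooth2_bootstrap with
    (fun k _ => (3 / 2 * (xi + 1) * xDpi xi k ^ 2 - 2 * xDpi xi k ^ 3)
                / cslope xi k (xDpi xi k) (xDpi xi k)) (fun _ _ => 0).
  - intros k y; apply xDpi_continuous2; exact Hxi.
  - intros k y Hk; split; [|auto_derive; trivial].
    assert (Hc := continuity_2d_pt_fst _ _ _ (xDpi_continuous2 xi k y Hxi Hk)).
    cbv beta in Hc.
    apply (implicit_derive (xDpi xi) (fun k' => cslope xi k' (xDpi xi k) (xDpi xi k'))
             (fun _ => 3 / 2 * (xi + 1) * xDpi xi k ^ 2 - 2 * xDpi xi k ^ 3)).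
    + unfold cslope; cont.
    + cont.
    + apply Rgt_not_eq, cslope_pos; assumption.
    + assert (HL := locally_2d_1d_const_y _ _ _ (krange_open xi k y Hk)).
      apply filter_imp with (2 := HL); intros k' Hk'.
      (* With both root equations, the left side becomes the change of the cubic at the fixed point
         [xDpi xi k] when only the coefficient moves, which is linear in [k' - k]. *)
      rewrite <- cslope_spec, (xDpi_root xi k' Hxi Hk').
      transitivity (dpi_cubic k xi (xDpi xi k) - dpi_cubic k' xi (xDpi xi k));
        [rewrite (xDpi_root xi k Hxi Hk); ring|unfold dpi_cubic; field].
  - intros n Hz; assert (HU := krange_open xi).
    split; [|apply C2_const].
    apply C2_div; trivial.
    + intros k y Hk; apply Rgt_not_eq, cslope_pos; assumption.
    + smooth.
    + unfold cslope; smooth.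
Qed.

(** * The well function and the pull-in voltage *)

(** For [0 < x < xi + 1] this is the squared voltage at which the potential energy at [x] equals
    that at the starting point 0, that is, at which a motion from rest at 0 has zero speed at
    [x]. *)
Definition well (xi k x : R) : R :=
  (xi + 1) * ((xi + 1 - x) * x + k / 2 * (xi + 1 - x) * x ^ 3).

Definition wslope (xi k x y : R) : R :=
  (xi + 1) * (xi + 1 - (x + y) + k / 2 * ((xi + 1) * (x ^ 2 + x * y + y ^ 2)
     - (x ^ 3 + x ^ 2 * y + x * y ^ 2 + y ^ 3))).

Lemma wslope_spec (xi k x y : R) : well xi k y - well xi k x = (y - x) * wslope xi k x y.
Proof. unfold well, wslope; field. Qed.

Lemma wslope_diag (xi k x : R) : wslope xi k x x = - (xi + 1) * dpi_cubic k xi x.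
Proof. unfold wslope, dpi_cubic; field. Qed.

Lemma well_derive (xi k x : R) : is_derive (well xi k) x (- (xi + 1) * dpi_cubic k xi x).
Proof. unfold well, dpi_cubic; auto_derive; [trivial|field]. Qed.

Lemma well_increasing (xi k x y : R) : 0 <= xi -> krange xi k ->
  x < y -> y <= xDpi xi k -> well xi k x < well xi k y.
Proof.
  intros Hxi Hk Hxy Hy.
  destruct (MVT_cor2 (well xi k) (fun x => - (xi + 1) * dpi_cubic k xi x) x y Hxy) as (c & E & Hc).
  { intros c _; apply is_derive_Reals, well_derive. }
  assert (dpi_cubic k xi c < 0) by (apply cubic_sign; trivial; lra).
  assert (0 < - (xi + 1) * dpi_cubic k xi c * (y - x)); [|lra].
  apply Rmult_lt_0_compat; [nra|lra].
Qed.

Lemma well_decreasing (xi k x y : R) : 0 <= xi -> krange xi k ->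
  x < y -> xDpi xi k <= x -> well xi k y < well xi k x.
Proof.
  intros Hxi Hk Hxy Hy.
  destruct (MVT_cor2 (well xi k) (fun x => - (xi + 1) * dpi_cubic k xi x) x y Hxy) as (c & E & Hc).
  { intros c _; apply is_derive_Reals, well_derive. }
  assert (0 < dpi_cubic k xi c) by (apply cubic_sign; trivial; lra).
  assert (0 < (xi + 1) * dpi_cubic k xi c * (y - x)); [|lra].
  apply Rmult_lt_0_compat; [nra|lra].
Qed.

Lemma well_max (xi k x : R) : 0 <= xi -> krange xi k -> x <> xDpi xi k ->
  well xi k x < well xi k (xDpi xi k).
Proof.
  intros Hxi Hk Hx; destruct (Rlt_dec x (xDpi xi k)).
  - apply well_increasing; trivial; lra.
  - apply well_decreasing; trivial; lra.
Qed.

Lemma well_max_le (xi k x : R) : 0 <= xi -> krange xi k ->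
  well xi k x <= well xi k (xDpi xi k).
Proof.
  intros Hxi Hk; destruct (Req_dec x (xDpi xi k)) as [->|Hx]; [lra|].
  apply Rlt_le, well_max; assumption.
Qed.

Lemma well_lt_k (xi k1 k2 x : R) : k1 < k2 -> 0 < x < xi + 1 -> well xi k1 x < well xi k2 x.
Proof.
  intros H Hx.
  replace (well xi k2 x) with
    (well xi k1 x + (xi + 1) * ((k2 - k1) / 2 * (xi + 1 - x) * x ^ 3)) by (unfold well; field).
  assert (0 < (xi + 1) * ((k2 - k1) / 2 * (xi + 1 - x) * x ^ 3)); [|lra].
  assert (0 < x ^ 3) by (apply pow_lt; lra).
  repeat apply Rmult_lt_0_compat; lra.
Qed.

Lemma well_pos (xi k x : R) : 0 < k -> 0 < x < xi + 1 -> 0 < well xi k x.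
Proof.
  intros Hk Hx; apply Rle_lt_trans with (well xi 0 x); [|apply well_lt_k; assumption].
  replace (well xi 0 x) with ((xi + 1) * ((xi + 1 - x) * x)) by (unfold well; field).
  repeat apply Rmult_le_pos; lra.
Qed.

Lemma well_xDpi_pos (xi k : R) : 0 <= xi -> krange xi k -> 0 < well xi k (xDpi xi k).
Proof.
  intros Hxi Hk; assert (B := xDpi_bounds xi k Hxi Hk).
  apply well_pos; [exact (proj1 Hk)|lra].
Qed.

Lemma VDpi_sqr (xi k : R) : 0 <= xi -> krange xi k ->
  VDpi xi k (xDpi xi k) ^ 2 = well xi k (xDpi xi k).
Proof.
  intros Hxi Hk; apply pow2_sqrt, Rlt_le; exact (well_xDpi_pos xi k Hxi Hk).
Qed.

Lemma VDpi_pos (xi k : R) : 0 <= xi -> krange xi k -> 0 < VDpi xi k (xDpi xi k).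
Proof. intros Hxi Hk; apply sqrt_lt_R0, (well_xDpi_pos xi k Hxi Hk). Qed.

Lemma VDpi_lt_iff (xi k V : R) : 0 <= xi -> krange xi k -> 0 < V ->
  V < VDpi xi k (xDpi xi k) <-> V ^ 2 < well xi k (xDpi xi k).
Proof.
  intros Hxi Hk HV; rewrite <- (VDpi_sqr xi k Hxi Hk).
  assert (P := VDpi_pos xi k Hxi Hk); split; intros H; nra.
Qed.

Lemma VDpi_smooth (xi : R) : 0 <= xi ->
  smooth2 (fun k _ => krange xi k) (fun k _ => VDpi xi k (xDpi xi k)).
Proof.
  intros Hxi n; assert (HU := krange_open xi).
  apply C2_sqrt; trivial.
  - intros k y Hk; exact (well_xDpi_pos xi k Hxi Hk).
  - assert (Hx := xDpi_smooth xi Hxi n).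
    unfold Rdiv; smooth.
Qed.

(** Comparison of maxima: a larger [k] raises [well] at the old maximizer, and the new maximum is at
    least that value. *)
Lemma VDpi_increasing (xi k1 k2 : R) : 0 <= xi -> krange xi k1 -> krange xi k2 ->
  k1 < k2 -> VDpi xi k1 (xDpi xi k1) < VDpi xi k2 (xDpi xi k2).
Proof.
  intros Hxi H1 H2 H12; assert (B := xDpi_bounds xi k1 Hxi H1).
  apply VDpi_lt_iff; trivial; [apply VDpi_pos; trivial|].
  rewrite VDpi_sqr by assumption.
  apply Rlt_le_trans with (well xi k2 (xDpi xi k1)).
  - apply well_lt_k; lra.
  - apply well_max_le; assumption.
Qed.

(** Extending by the limit value to [t <= 0] turns a one-sided limit into ordinary continuity at 0,
    so that two-sided continuity lemmas and the mean value theorem apply. *)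
Definition right_ext (f : R -> R) (c t : R) : R := if Rle_dec t 0 then c else f t.

Lemma right_ext_pos (f : R -> R) (c t : R) : 0 < t -> right_ext f c t = f t.
Proof. intros Ht; unfold right_ext; destruct (Rle_dec t 0); [lra|reflexivity]. Qed.

Lemma right_ext_0 (f : R -> R) (c t : R) : t <= 0 -> right_ext f c t = c.
Proof. intros Ht; unfold right_ext; destruct (Rle_dec t 0); [reflexivity|lra]. Qed.

Lemma locally_gt (x t : R) : x < t -> locally t (fun u => x < u).
Proof. intros H; exact (open_gt x t H). Qed.

Lemma locally_lt (x t : R) : t < x -> locally t (fun u => u < x).
Proof. intros H; exact (open_lt x t H). Qed.

Lemma right_ext_continuous_0 (f : R -> R) (c : R) :
  filterlim f (at_right 0) (locally c) -> continuity_pt (right_ext f c) 0.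
Proof.
  intros Hf; apply continuity_pt_filterlim; rewrite right_ext_0 by lra.
  intros P HP; assert (HP' := Hf P HP).
  unfold filtermap, at_right, within in HP' |- *.
  apply filter_imp with (2 := HP'); intros t Ht.
  destruct (Rlt_dec 0 t) as [H|H].
  - rewrite right_ext_pos by exact H; exact (Ht H).
  - rewrite right_ext_0 by lra; exact (locally_singleton _ _ HP).
Qed.

Lemma filterlim_right (f g : R -> R) (c : R) :
  continuity_pt g 0 -> locally 0 (fun t => 0 < t -> f t = g t) -> g 0 = c ->
  filterlim f (at_right 0) (locally c).
Proof.
  intros Hg He <- P HP; apply continuity_pt_filterlim in Hg.
  generalize (filter_and _ _ He (Hg P HP)); unfold filtermap, at_right, within.
  apply filter_imp; intros t [E H] Ht; rewrite (E Ht); exact H.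
Qed.

(** * Limits as the cubic stiffness tends to 0 *)

Lemma krange_near_0 (xi : R) : 0 <= xi -> locally 0 (fun k => 0 < k -> krange xi k).
Proof.
  intros Hxi; assert (P : 0 < 16 / (3 * (xi + 1) ^ 2)).
  { apply Rdiv_lt_0_compat; [lra|]; assert (0 < (xi + 1) ^ 2) by (apply pow_lt; lra); lra. }
  apply filter_imp with (2 := locally_lt _ _ P); intros k H1 H2; split; assumption.
Qed.

(** The root equation reads [2 (x - (xi + 1) / 2) = k x^2 (3 / 2 (xi + 1) - 2 x)], whose right side
    is at most [k (xi + 1)^3]; hence the choice [k < eps / (xi + 1)^3]. *)
Lemma xDpi_lim_0 (xi : R) : 0 <= xi ->
  filterlim (xDpi xi) (at_right 0) (locally ((xi + 1) / 2)).
Proof.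
  intros Hxi.
  assert (Pa : 0 < (xi + 1) ^ 3) by (apply pow_lt; lra).
  apply filterlim_locally; intros eps.
  assert (Pe : 0 < eps / (xi + 1) ^ 3) by (apply Rdiv_lt_0_compat; [apply cond_pos|exact Pa]).
  assert (HL := filter_and _ _ (krange_near_0 xi Hxi) (locally_lt _ _ Pe)).
  unfold at_right, within; apply filter_imp with (2 := HL); intros k [Hk Hs] H0; specialize (Hk H0).
  assert (B := xDpi_bounds xi k Hxi Hk); assert (E := xDpi_root xi k Hxi Hk).
  set (x := xDpi xi k) in *.
  apply (Rmult_lt_compat_r _ _ _ Pa) in Hs.
  replace (eps / (xi + 1) ^ 3 * (xi + 1) ^ 3) with (pos eps) in Hs by (field; lra).
  assert (E2 : 2 * (x - (xi + 1) / 2) = k * (x ^ 2 * (3 / 2 * (xi + 1) - 2 * x)))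
    by (unfold dpi_cubic in E; lra).
  assert (x ^ 2 * (3 / 2 * (xi + 1) - 2 * x) <= (xi + 1) ^ 2 * (xi + 1)).
  { apply Rmult_le_compat; [apply pow2_ge_0|lra| |lra].
    apply pow_incr; lra. }
  assert (k * (x ^ 2 * (3 / 2 * (xi + 1) - 2 * x)) <= k * ((xi + 1) ^ 2 * (xi + 1)))
    by (apply Rmult_le_compat_l; lra).
  change (Rabs (x - (xi + 1) / 2) < eps); apply Rabs_def1; lra.
Qed.

Lemma VDpi_lim_0 (xi : R) : 0 <= xi ->
  filterlim (fun k => VDpi xi k (xDpi xi k)) (at_right 0)
            (locally ((xi + 1) * sqrt (xi + 1) / 2)).
Proof.
  intros Hxi.
  assert (Hc := right_ext_continuous_0 _ _ (xDpi_lim_0 xi Hxi)).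
  set (z := right_ext (xDpi xi) ((xi + 1) / 2)) in Hc.
  apply filterlim_right with (fun k => sqrt (well xi k (z k))).
  - apply (cpt_comp (fun k => well xi k (z k)) sqrt).
    + apply continuity_pt_sqrt; unfold well, z; rewrite right_ext_0 by lra.
      apply Rmult_le_pos; [lra|].
      replace ((xi + 1 - (xi + 1) / 2) * ((xi + 1) / 2)
               + 0 / 2 * (xi + 1 - (xi + 1) / 2) * ((xi + 1) / 2) ^ 3)
        with (((xi + 1) / 2) ^ 2) by field.
      apply pow2_ge_0.
    + unfold well; unfold Rdiv at 1; cont.
  - apply filter_forall; intros k Hk; unfold z; rewrite right_ext_pos by exact Hk; reflexivity.
  - unfold well, z; rewrite right_ext_0 by lra.
    replace ((xi + 1) * ((xi + 1 - (xi + 1) / 2) * ((xi + 1) / 2)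
               + 0 / 2 * (xi + 1 - (xi + 1) / 2) * ((xi + 1) / 2) ^ 3))
        with (((xi + 1) / 2) ^ 2 * (xi + 1)) by field.
    rewrite sqrt_mult by (try apply pow2_ge_0; lra).
    rewrite sqrt_pow2 by lra; field.
Qed.

(** * The stagnation displacement *)

Definition srange (xi k V : R) : Prop := krange xi k /\ 0 < V < VDpi xi k (xDpi xi k).

(** Searching to the left of [xDpi], where [well] increases, singles out the first positive zero of
    [V^2 - well]; zeros beyond the maximum are excluded. *)
Definition peak (xi k V : R) : R :=
  epsilon (inhabits 0) (fun x => 0 < x < xDpi xi k /\ well xi k x = V ^ 2).

Lemma peak_spec (xi k V : R) : 0 <= xi -> srange xi k V ->
  0 < peak xi k V < xDpi xi k /\ well xi k (peak xi k V) = V ^ 2.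
Proof.
  intros Hxi (Hk & HV & HD).
  apply (epsilon_spec (inhabits 0) (fun x => 0 < x < xDpi xi k /\ well xi k x = V ^ 2)).
  apply VDpi_lt_iff in HD; trivial.
  assert (B := xDpi_bounds xi k Hxi Hk).
  assert (W0 : well xi k 0 = 0) by (unfold well; ring).
  assert (PV : 0 < V ^ 2) by (apply pow_lt; lra).
  destruct (IVT_gen (well xi k) 0 (xDpi xi k) (V ^ 2)) as [x [Hx Ex]].
  - intros x; unfold well; cont.
  - rewrite Rmin_left, Rmax_right; lra.
  - rewrite Rmin_left, Rmax_right in Hx by lra.
    exists x; split; [|exact Ex]; split.
    + destruct (Req_dec x 0) as [->|]; lra.
    + destruct (Req_dec x (xDpi xi k)) as [E|]; [rewrite E in Ex|]; lra.
Qed.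

(** Up to [peak] the function [well] does not exceed [V^2]. This comparison yields the monotonicity
    in both parameters and the explicit upper bound. *)
Lemma peak_lt (xi k V x : R) : 0 <= xi -> srange xi k V ->
  V ^ 2 < well xi k x -> peak xi k V < x.
Proof.
  intros Hxi H Hx; destruct (peak_spec xi k V Hxi H) as [B E].
  destruct (Rlt_le_dec (peak xi k V) x) as [|C]; [assumption|exfalso].
  destruct C as [C| ->]; [|lra].
  assert (well xi k x < well xi k (peak xi k V)); [|lra].
  apply well_increasing; trivial; [apply H|lra].
Qed.

Lemma peak_gt (xi k V x : R) : 0 <= xi -> srange xi k V ->
  x <= xDpi xi k -> well xi k x < V ^ 2 -> x < peak xi k V.
Proof.
  intros Hxi H HD Hx; destruct (peak_spec xi k V Hxi H) as [B E].
  destruct (Rlt_le_dec x (peak xi k V)) as [|C]; [assumption|exfalso].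
  destruct C as [C|C]; [|rewrite <- C in Hx; lra].
  assert (well xi k (peak xi k V) < well xi k x); [|lra].
  apply well_increasing; trivial; apply H.
Qed.

Lemma peak_decreasing_k (xi k1 k2 V : R) : 0 <= xi -> krange xi k1 -> krange xi k2 ->
  k1 < k2 -> 0 < V < VDpi xi k1 (xDpi xi k1) -> peak xi k2 V < peak xi k1 V.
Proof.
  intros Hxi H1 H2 H12 HV.
  assert (D := VDpi_increasing xi k1 k2 Hxi H1 H2 H12).
  assert (S1 : srange xi k1 V) by (split; assumption).
  assert (S2 : srange xi k2 V) by (split; [assumption|lra]).
  destruct (peak_spec xi k1 V Hxi S1) as [B E].
  assert (B1 := xDpi_bounds xi k1 Hxi H1).
  apply peak_lt; trivial; rewrite <- E; apply well_lt_k; lra.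
Qed.

Lemma peak_increasing_V (xi k V1 V2 : R) : 0 <= xi -> krange xi k ->
  0 < V1 -> V1 < V2 -> V2 < VDpi xi k (xDpi xi k) -> peak xi k V1 < peak xi k V2.
Proof.
  intros Hxi Hk H1 H12 H2.
  assert (S1 : srange xi k V1) by (split; [assumption|lra]).
  assert (S2 : srange xi k V2) by (split; [assumption|lra]).
  destruct (peak_spec xi k V2 Hxi S2) as [B E].
  apply peak_lt; trivial; rewrite E; nra.
Qed.

(** The bound is the smaller root of [well xi 0 x = V^2], a quadratic equation (linear spring) whose
    discriminant is positive by the assumption on [V]. A positive [k] raises [well] there
    strictly. *)
Lemma peak_linear_bound (xi k V : R) : 0 <= xi -> srange xi k V ->
  V < (xi + 1) * sqrt (xi + 1) / 2 ->
  peak xi k V < (xi + 1) / 2 - / 2 * sqrt ((xi + 1) ^ 2 - 4 * V ^ 2 / (xi + 1)).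
Proof.
  intros Hxi H HV; assert (H' := H); destruct H' as (Hk & PV & _).
  assert (Q : 4 * V ^ 2 / (xi + 1) < (xi + 1) ^ 2).
  { assert (V ^ 2 < ((xi + 1) * sqrt (xi + 1) / 2) ^ 2) by nra.
    replace (((xi + 1) * sqrt (xi + 1) / 2) ^ 2)
      with ((xi + 1) ^ 2 * (sqrt (xi + 1)) ^ 2 / 4) in H0 by field.
    rewrite pow2_sqrt in H0 by lra.
    apply (Rmult_lt_reg_r (xi + 1)); [lra|].
    replace (4 * V ^ 2 / (xi + 1) * (xi + 1)) with (4 * V ^ 2) by (field; lra); lra. }
  set (s := sqrt ((xi + 1) ^ 2 - 4 * V ^ 2 / (xi + 1))).
  assert (Es : s ^ 2 = (xi + 1) ^ 2 - 4 * V ^ 2 / (xi + 1)) by (apply pow2_sqrt; lra).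
  assert (Ps : 0 < s) by (apply sqrt_lt_R0; lra).
  assert (Q0 : 0 < 4 * V ^ 2 / (xi + 1))
    by (apply Rdiv_lt_0_compat; [assert (0 < V ^ 2) by (apply pow_lt; lra)|]; lra).
  assert (s < xi + 1) by nra.
  apply peak_lt; trivial.
  apply Rle_lt_trans with (well xi 0 ((xi + 1) / 2 - / 2 * s)).
  - right; transitivity ((xi + 1) * ((xi + 1) ^ 2 - s ^ 2) / 4); [|unfold well; field].
    rewrite Es; field; lra.
  - apply well_lt_k; [exact (proj1 Hk)|lra].
Qed.

Lemma srange_open (xi : R) : 0 <= xi -> open2 (srange xi).
Proof.
  intros Hxi k V (Hk & PV & HD).
  apply VDpi_lt_iff in HD; trivial.
  assert (L1 : locally_2d (fun _ v => - v < 0) k V)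
    by (apply (c2d_locally_lt (fun _ v => - v)); [cont2|lra]).
  (* The test point stays at the old maximizer: [v^2] below [well] at one point is already below its
     maximum for [u]. *)
  assert (L2 : locally_2d (fun u v => v * v - well xi u (xDpi xi k) < 0) k V).
  { apply (c2d_locally_lt (fun u v => v * v - well xi u (xDpi xi k))); [|lra].
    unfold well, Rdiv; cont2. }
  destruct (locally_2d_and _ _ _ _ (krange_open xi k V Hk) (locally_2d_and _ _ _ _ L1 L2))
    as [d Hd].
  exists d; intros u v Hu Hv; destruct (Hd u v Hu Hv) as (K & P & Q).
  assert (Pv : 0 < v) by lra.
  split; [exact K|]; split; [exact Pv|]; apply VDpi_lt_iff; trivial.
  apply Rlt_le_trans with (well xi u (xDpi xi k)); [lra|apply well_max_le; assumption].
Qed.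

Lemma peak_continuous2 (xi k V : R) : 0 <= xi -> srange xi k V ->
  continuity_2d_pt (peak xi) k V.
Proof.
  intros Hxi H eps; destruct (peak_spec xi k V Hxi H) as [B E].
  assert (Hk := proj1 H).
  set (z := peak xi k V) in *; set (D := xDpi xi k) in *.
  (* The cap keeps [z + e] left of [D], where [well] still increases. [L1] below keeps [z - e] left
     of the maximizer for nearby parameters, as [peak_gt] demands. *)
  set (e := Rmin eps ((D - z) / 2)).
  assert (He : 0 < e) by (apply Rmin_pos; [apply cond_pos|lra]).
  assert (He1 : e <= eps) by apply Rmin_l.
  assert (He2 : e <= (D - z) / 2) by apply Rmin_r.
  assert (L1 : locally_2d (fun u _ => dpi_cubic u xi (z - e) < 0) k V).
  { apply (c2d_locally_lt (fun u _ => dpi_cubic u xi (z - e))).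
    - unfold dpi_cubic; cont2.
    - apply cubic_sign; trivial; fold D; lra. }
  assert (L2 : locally_2d (fun u v => well xi u (z - e) - v * v < 0) k V).
  { apply (c2d_locally_lt (fun u v => well xi u (z - e) - v * v)).
    - unfold well, Rdiv; cont2.
    - assert (well xi k (z - e) < well xi k z); [|lra].
      apply well_increasing; trivial; fold D; lra. }
  assert (L3 : locally_2d (fun u v => v * v - well xi u (z + e) < 0) k V).
  { apply (c2d_locally_lt (fun u v => v * v - well xi u (z + e))).
    - unfold well, Rdiv; cont2.
    - assert (well xi k z < well xi k (z + e)); [|lra].
      apply well_increasing; trivial; fold D; lra. }
  destruct (locally_2d_and _ _ _ _ (srange_open xi Hxi k V H)
    (locally_2d_and _ _ _ _ L1 (locally_2d_and _ _ _ _ L2 L3))) as [d Hd].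
  exists d; intros u v Hu Hv; destruct (Hd u v Hu Hv) as (S & C1 & C2' & C3).
  apply (cubic_sign xi u _ Hxi (proj1 S)) in C1.
  assert (peak xi u v < z + e) by (apply peak_lt; trivial; lra).
  assert (z - e < peak xi u v) by (apply peak_gt; trivial; lra).
  apply Rabs_def1; lra.
Qed.

Lemma wslope_peak_pos (xi k V : R) : 0 <= xi -> srange xi k V ->
  0 < wslope xi k (peak xi k V) (peak xi k V).
Proof.
  intros Hxi H; destruct (peak_spec xi k V Hxi H) as [B E].
  assert (dpi_cubic k xi (peak xi k V) < 0) by (apply cubic_sign; trivial; [apply H|lra]).
  rewrite wslope_diag; nra.
Qed.

Lemma peak_smooth (xi : R) : 0 <= xi -> smooth2 (srange xi) (peak xi).
Proof.
  intros Hxi; assert (HU := srange_open xi Hxi).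
  apply smooth2_bootstrap with
    (fun k V => (xi + 1) * ((peak xi k V - (xi + 1)) / 2 * peak xi k V ^ 3)
                / wslope xi k (peak xi k V) (peak xi k V))
    (fun k V => (V + V) / wslope xi k (peak xi k V) (peak xi k V)).
  - intros k V H; apply peak_continuous2; assumption.
  - intros k V H; assert (Hc := peak_continuous2 xi k V Hxi H).
    destruct (peak_spec xi k V Hxi H) as [B E].
    assert (N : wslope xi k (peak xi k V) (peak xi k V) <> 0)
      by (apply Rgt_not_eq, wslope_peak_pos; assumption).
    split.
    + assert (Hc1 := continuity_2d_pt_fst _ _ _ Hc); cbv beta in Hc1.
      apply (implicit_derive (fun u => peak xi u V)
        (fun u => wslope xi u (peak xi k V) (peak xi u V))
        (fun _ => (xi + 1) * ((peak xi k V - (xi + 1)) / 2 * peak xi k V ^ 3))); trivial.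
      * unfold wslope, Rdiv; cont.
      * cont.
      * assert (HL := locally_2d_1d_const_y _ _ _ (HU k V H)).
        apply filter_imp with (2 := HL); intros u Hu.
        rewrite <- wslope_spec; destruct (peak_spec xi u V Hxi Hu) as [_ E'].
        rewrite E', <- E; unfold well; field.
    + assert (Hc2 := continuity_2d_pt_snd _ _ _ Hc); cbv beta in Hc2.
      (* The difference of the defining equations is [w^2 - V^2 = (w - V) (w + V)], hence the factor
         [w + V], which becomes [V + V] at the base point. *)
      apply (implicit_derive (fun w => peak xi k w)
        (fun w => wslope xi k (peak xi k V) (peak xi k w)) (fun w => w + V)); trivial.
      * unfold wslope, Rdiv; cont.
      * cont.
      * assert (HL := locally_2d_1d_const_x _ _ _ (HU k V H)).
        apply filter_imp with (2 := HL); intros w Hw.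
        rewrite <- wslope_spec; destruct (peak_spec xi k w Hxi Hw) as [_ E'].
        rewrite E', E; ring.
  - intros n Hz.
    assert (N : forall k V, srange xi k V -> wslope xi k (peak xi k V) (peak xi k V) <> 0)
      by (intros; apply Rgt_not_eq, wslope_peak_pos; assumption).
    split; apply C2_div; trivial; unfold wslope, Rdiv; smooth.
Qed.

(** * Uniqueness of the response *)

Lemma is_derive_cpt (f : R -> R) (t l : R) : is_derive f t l -> continuity_pt f t.
Proof.
  intros H; apply is_derive_Reals in H.
  apply derivable_continuous_pt; exists l; exact H.
Qed.

Lemma right_ext_derive (f : R -> R) (c t l : R) :
  0 < t -> is_derive f t l -> is_derive (right_ext f c) t l.
Proof.
  intros Ht; apply is_derive_ext_loc.
  apply filter_imp with (2 := locally_gt 0 t Ht); intros u Hu.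
  symmetry; apply right_ext_pos, Hu.
Qed.

(** Gronwall's argument in the phase plane: the squared distance [E] satisfies [E' <= M E] and
    [E 0 = 0], so the mean value theorem for [E s * exp (- M s)] forces [E t1 = 0]. *)
Lemma response_unique (kappa xi V : R) (T1 T2 : Rbar) (x y : R -> R) :
  is_response kappa xi V T1 x -> is_response kappa xi V T2 y ->
  forall t, 0 <= t -> Rbar_lt t T1 -> Rbar_lt t T2 -> y t = x t.
Proof.
  intros (v & x0 & v0 & xlt & xd & xc & vc) (w & y0 & w0 & ylt & yd & yc & wc) t1 Ht1 HT1 HT2.
  destruct Ht1 as [Ht1| <-]; [|congruence].
  assert (below : forall s, s <= t1 -> Rbar_lt s T1 /\ Rbar_lt s T2).
  { intros s Hs; split; eapply Rbar_le_lt_trans; eauto; exact Hs. }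
  set (X := right_ext x 0); set (Y := right_ext y 0).
  set (X' := right_ext v 0); set (Y' := right_ext w 0).
  assert (XD : forall s, 0 < s <= t1 ->
     is_derive X s (X' s) /\ is_derive X' s (rhs kappa xi V (X s))).
  { intros s Hs; destruct (xd s) as [D1 D2]; [lra|apply below; lra|].
    unfold X', X; rewrite !right_ext_pos by lra.
    split; apply right_ext_derive; trivial; lra. }
  assert (YD : forall s, 0 < s <= t1 ->
     is_derive Y s (Y' s) /\ is_derive Y' s (rhs kappa xi V (Y s))).
  { intros s Hs; destruct (yd s) as [D1 D2]; [lra|apply below; lra|].
    unfold Y', Y; rewrite !right_ext_pos by lra.
    split; apply right_ext_derive; trivial; lra. }
  assert (cont_from : forall f f' : R -> R, filterlim f (at_right 0) (locally 0) ->
     (forall s, 0 < s <= t1 -> is_derive (right_ext f 0) s (f' s)) ->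
     forall s, 0 <= s <= t1 -> continuity_pt (right_ext f 0) s).
  { intros f f' Hf Hd s [[Hs| <-] Hs1].
    - apply is_derive_cpt with (f' s), Hd; lra.
    - apply right_ext_continuous_0, Hf. }
  assert (XC := cont_from x _ xc (fun s Hs => proj1 (XD s Hs))).
  assert (YC := cont_from y _ yc (fun s Hs => proj1 (YD s Hs))).
  assert (X'C := cont_from v _ vc (fun s Hs => proj2 (XD s Hs))).
  assert (Y'C := cont_from w _ wc (fun s Hs => proj2 (YD s Hs))).
  fold X Y X' Y' in XC, YC, X'C, Y'C.
  assert (lt_of : forall s, 0 <= s <= t1 -> X s < xi + 1 /\ Y s < xi + 1).
  { intros s Hs; destruct (Req_dec s 0) as [->|N].
    - unfold X, Y; rewrite !right_ext_0 by lra; rewrite <- x0 at 1; rewrite <- y0.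
      split; [apply xlt|apply ylt]; (lra || apply below; lra).
    - unfold X, Y; rewrite !right_ext_pos by lra.
      split; [apply xlt|apply ylt]; (lra || apply below; lra). }
  (* Divided difference of [rhs] along the two responses. As [rhs] is singular at [xi + 1], the
     bound comes from compactness of [[0, t1]], on which both responses stay below [xi + 1]. *)
  set (K s := - 1 - kappa * (X s ^ 2 + X s * Y s + Y s ^ 2)
     + / 2 * V ^ 2 * (2 * (xi + 1) - X s - Y s)
       * / ((xi + 1 - X s) ^ 2 * (xi + 1 - Y s) ^ 2)).
  assert (KE : forall s, 0 <= s <= t1 ->
     rhs kappa xi V (X s) - rhs kappa xi V (Y s) = (X s - Y s) * K s).
  { intros s Hs; destruct (lt_of s Hs); unfold rhs, K; field; lra. }
  assert (KC : forall s, 0 <= s <= t1 -> continuity_pt (fun s => (1 + K s) ^ 2) s).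
  { intros s Hs; specialize (XC s Hs); specialize (YC s Hs); destruct (lt_of s Hs).
    unfold K; cont.
    apply Rmult_integral_contrapositive_currified; apply pow_nonzero; lra. }
  destruct (continuity_ab_maj _ 0 t1 (Rlt_le _ _ Ht1) KC) as [m [Hm _]].
  (* With [p], [q] the differences of position and velocity, [E' = 2 p q (1 + K)], at most
     [(1 + (1 + K)^2) (p^2 + q^2)]; the square needs no sign of [1 + K]. *)
  set (M := 1 + (1 + K m) ^ 2) in *; cbv beta in Hm.
  set (E s := (X s - Y s) ^ 2 + (X' s - Y' s) ^ 2).
  assert (E0 : E 0 = 0).
  { unfold E, X, Y, X', Y'; rewrite !right_ext_0 by lra; ring. }
  destruct (MVT_gen (fun s => E s * exp (- M * s)) 0 t1
    (fun s => (2 * (X s - Y s) * (X' s - Y' s) * (1 + K s) - M * E s) * exp (- M * s)))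
    as (c & Hc & Ec).
  - rewrite Rmin_left, Rmax_right by lra; intros s Hs.
    destruct (XD s ltac:(lra)) as [D1 D2], (YD s ltac:(lra)) as [D3 D4].
    assert (Ke := KE s ltac:(lra)).
    unfold E; auto_derive.
    + repeat split; eexists; eassumption.
    + replace (Derive (fun u => X u) s) with (X' s) by (symmetry; apply is_derive_unique, D1).
      replace (Derive (fun u => Y u) s) with (Y' s) by (symmetry; apply is_derive_unique, D3).
      replace (Derive (fun u => X' u) s) with (rhs kappa xi V (X s))
        by (symmetry; apply is_derive_unique, D2).
      replace (Derive (fun u => Y' u) s) with (rhs kappa xi V (Y s))
        by (symmetry; apply is_derive_unique, D4).
      replace (rhs kappa xi V (X s)) with (rhs kappa xi V (Y s) + (X s - Y s) * K s) by lra.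
      ring.
  - rewrite Rmin_left, Rmax_right by lra; intros s Hs.
    specialize (XC s Hs); specialize (YC s Hs); specialize (X'C s Hs); specialize (Y'C s Hs).
    unfold E; apply cpt_mult; [cont|].
    apply (cpt_comp (fun u => - M * u) exp); [|cont].
    apply derivable_continuous_pt, derivable_pt_exp.
  - rewrite Rmin_left, Rmax_right in Hc by lra; rewrite E0 in Ec.
    specialize (Hm c Hc).
    assert (Hneg : 2 * (X c - Y c) * (X' c - Y' c) * (1 + K c) - M * E c <= 0).
    { unfold E; set (p := X c - Y c); set (q := X' c - Y' c); set (r := 1 + K c) in *.
      assert (2 * p * q * r <= (1 + r ^ 2) * (p ^ 2 + q ^ 2)).
      { assert (0 <= (p * r - q) ^ 2) by apply pow2_ge_0.
        assert (0 <= p ^ 2) by apply pow2_ge_0.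
        assert (0 <= (q * r) ^ 2) by apply pow2_ge_0.
        nra. }
      assert ((1 + r ^ 2) * (p ^ 2 + q ^ 2) <= M * (p ^ 2 + q ^ 2)).
      { apply Rmult_le_compat_r; [|unfold M; lra].
        apply Rplus_le_le_0_compat; apply pow2_ge_0. }
      lra. }
    assert (Pc := exp_pos (- M * c)); assert (P1 := exp_pos (- M * t1)).
    assert (HE : E t1 * exp (- M * t1) <= 0).
    { replace (E t1 * exp (- M * t1)) with (E t1 * exp (- M * t1) - 0 * exp (- M * 0)) by ring.
      rewrite Ec, Rminus_0_r.
      assert (0 <= - (2 * (X c - Y c) * (X' c - Y' c) * (1 + K c) - M * E c)
                   * exp (- M * c) * t1) by (repeat apply Rmult_le_pos; lra).
      lra. }
    assert (HE1 : E t1 <= 0) by nra.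
    assert (X t1 - Y t1 = 0).
    { assert (S1 := pow2_ge_0 (X t1 - Y t1)); assert (S2 := pow2_ge_0 (X' t1 - Y' t1)).
      unfold E in HE1; apply Rsqr_0_uniq; unfold Rsqr; lra. }
    unfold X, Y in H; rewrite !right_ext_pos in H by lra; lra.
Qed.

(** * Responses by quadrature *)

(** With [g] the reciprocal of the phase speed, this is the time at which the phase reaches [u]. *)
Definition clock (g : R -> R) (u : R) : R := RInt g 0 u.

Lemma clock_0 (g : R -> R) : clock g 0 = 0.
Proof. exact (RInt_point 0 g). Qed.

Lemma clock_derive (g : R -> R) (u : R) : continuity g ->
  is_derive (clock g) u (g u).
Proof.
  intros Hg; apply (is_derive_RInt g (clock g) 0).
  - apply filter_forall; intros w; apply (RInt_correct (V := R_CompleteNormedModule)).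
    apply (ex_RInt_continuous (V := R_CompleteNormedModule)).
    intros z _; apply continuity_pt_filterlim, Hg.
  - apply continuity_pt_filterlim, Hg.
Qed.

Lemma clock_continuity (g : R -> R) : continuity g -> continuity (clock g).
Proof. intros Hg u; exact (is_derive_cpt _ _ _ (clock_derive g u Hg)). Qed.

Lemma clock_increasing (g : R -> R) (b : Rbar) : continuity g ->
  (forall u, 0 <= u -> Rbar_lt u b -> 0 < g u) ->
  forall u w, 0 <= u -> u < w -> Rbar_le w b -> clock g u < clock g w.
Proof.
  intros Hg Hp u w Hu Huw Hw.
  destruct (MVT_cor2 (clock g) g u w Huw) as (c & E & Hc).
  { intros c _; apply is_derive_Reals, clock_derive, Hg. }
  assert (0 < g c).
  { apply Hp; [lra|]; apply Rbar_lt_le_trans with w; [exact (proj2 Hc)|exact Hw]. }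
  assert (0 < g c * (w - u)) by (apply Rmult_lt_0_compat; lra).
  lra.
Qed.

(** Phases below [b] correspond to times below [T]. Both are infinite in the periodic and threshold
    regimes; in the contact regime [b = 1] and [T] is the contact time. The comparison clauses let
    later proofs locate [th t] from clock values alone. *)
Lemma clock_inverse (g : R -> R) (b T : Rbar) : continuity g ->
  (forall u, 0 <= u -> Rbar_lt u b -> 0 < g u) ->
  Rbar_lt 0 T ->
  (forall t, 0 <= t -> Rbar_lt t T -> exists u, 0 <= u /\ Rbar_lt u b /\ clock g u = t) ->
  exists th : R -> R,
    th 0 = 0 /\
    (forall t, 0 <= t -> Rbar_lt t T -> 0 <= th t /\ Rbar_lt (th t) b /\ clock g (th t) = t) /\
    (forall t u, 0 <= t -> Rbar_lt t T -> 0 <= u -> Rbar_lt u b ->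
       (clock g u < t -> u < th t) /\ (t < clock g u -> th t < u) /\
       (clock g u = t -> th t = u)) /\
    (forall t, 0 < t -> Rbar_lt t T -> is_derive th t (/ g (th t))) /\
    filterlim th (at_right 0) (locally 0).
Proof.
  intros Hg Hp HT Hs.
  set (F := clock g).
  set (th (t : R) := epsilon (inhabits 0) (fun u : R => 0 <= u /\ Rbar_lt u b /\ F u = t)).
  assert (Hth : forall t, 0 <= t -> Rbar_lt t T -> 0 <= th t /\ Rbar_lt (th t) b /\ F (th t) = t).
  { intros t H1 H2.
    apply (epsilon_spec (inhabits 0) (fun u => 0 <= u /\ Rbar_lt u b /\ F u = t)), Hs; trivial. }
  assert (Fi : forall u w : R, 0 <= u -> Rbar_lt w b -> u < w -> F u < F w).
  { intros u w Hu Hw Huw; apply (clock_increasing g b Hg Hp u w Hu Huw).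
    apply Rbar_lt_le, Hw. }
  assert (Hc : forall t u, 0 <= t -> Rbar_lt t T -> 0 <= u -> Rbar_lt u b ->
       (F u < t -> u < th t) /\ (t < F u -> th t < u) /\ (F u = t -> th t = u)).
  { intros t u H1 H2 H3 H4; destruct (Hth t H1 H2) as (P & Q & E).
    destruct (Rtotal_order u (th t)) as [C|[C|C]].
    - specialize (Fi u (th t) H3 Q C); lra.
    - rewrite C, E; repeat split; lra.
    - specialize (Fi (th t) u P H4 C); lra. }
  assert (HL : forall t : R, Rbar_lt t T -> locally t (fun s => Rbar_lt s T)).
  { intros t Ht; exact (open_Rbar_lt' t T Ht). }
  assert (Hcont : forall t, 0 < t -> Rbar_lt t T -> continuity_pt th t).
  { intros t H1 H2; destruct (Hth t (Rlt_le _ _ H1) H2) as (P & Q & E).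
    assert (P' : 0 < th t).
    { destruct P as [P|P]; [exact P|exfalso].
      rewrite <- P in E; unfold F in E; rewrite clock_0 in E; lra. }
    apply continuity_pt_filterlim, filterlim_locally; intros eps.
    set (lo := Rmax 0 (th t - eps / 2)).
    assert (Hlo : 0 <= lo /\ th t - eps / 2 <= lo /\ lo < th t).
    { assert (Pe := cond_pos eps); split; [apply Rmax_l|split; [apply Rmax_r|]].
      apply Rmax_lub_lt; lra. }
    assert (Hhi : exists hi : R, th t < hi /\ hi <= th t + eps / 2 /\ Rbar_lt hi b).
    { assert (Pe := cond_pos eps).
      destruct b as [b| |]; simpl in Q |- *; [|exists (th t + eps / 2); lra|contradiction].
      exists (Rmin (th t + eps / 2) ((th t + b) / 2)).
      split; [apply Rmin_glb_lt; lra|split; [apply Rmin_l|]].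
      apply Rle_lt_trans with ((th t + b) / 2); [apply Rmin_r|lra]. }
    destruct Hhi as (hi & G1 & G2 & G3).
    assert (A1 : F lo < t) by (rewrite <- E; apply Fi; trivial; lra).
    assert (A2 : t < F hi) by (rewrite <- E at 1; apply Fi; trivial; lra).
    assert (HA := filter_and _ _ (HL t H2) (filter_and _ _ (locally_gt _ _ H1)
       (filter_and _ _ (locally_gt _ _ A1) (locally_lt _ _ A2)))).
    apply filter_imp with (2 := HA); intros s (B1 & B2 & B3 & B4).
    assert (Pe := cond_pos eps).
    assert (lo < th s).
    { apply (Hc s lo); trivial; try lra.
      apply Rbar_lt_trans with (th t); [simpl; lra|exact Q]. }
    assert (th s < hi) by (apply (Hc s hi); trivial; lra).
    change (Rabs (th s - th t) < eps); apply Rabs_def1; lra. }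
  assert (F0 : F 0 = 0) by apply clock_0.
  assert (b0 : Rbar_lt 0 b).
  { destruct (Hs 0 (Rle_refl 0) HT) as (u & Hu & Hub & _).
    apply Rbar_le_lt_trans with u; assumption. }
  exists th; split; [|split; [exact Hth|split; [exact Hc|split]]].
  - apply (Hc 0 0); trivial; lra.
  - intros t H1 H2; destruct (Hth t (Rlt_le _ _ H1) H2) as (P & Q & E).
    (* Since [F (th r) = r], the slope identity reads [r - t = (th r - th t) * s (th r)], which is
       the form [implicit_derive] expects with numerator 1. *)
    destruct (derive_slope F (th t) _ (clock_derive g (th t) Hg)) as (s & Es & Cs & Ls).
    assert (Gp := Hp (th t) P Q); cbv beta in Ls.
    replace (/ g (th t)) with (1 / s (th t)) by (rewrite Ls; field; lra).
    apply (implicit_derive th (fun r => s (th r)) (fun _ => 1)).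
    + apply cpt_comp; [exact Cs|apply Hcont; trivial].
    + apply cpt_const.
    + rewrite Ls; lra.
    + assert (HA := filter_and _ _ (HL t H2) (locally_gt _ _ H1)).
      apply filter_imp with (2 := HA); intros r (B1 & B2).
      rewrite <- Es, E, Rmult_1_r; f_equal; apply Hth; [lra|exact B1].
  - apply filterlim_locally; intros eps; unfold at_right, within.
    assert (Pe := cond_pos eps).
    assert (Hhi : exists hi : R, 0 < hi /\ hi < eps /\ Rbar_lt hi b).
    { destruct b as [b| |]; simpl in b0 |- *; [|exists (eps / 2); lra|contradiction].
      exists (Rmin (eps / 2) (b / 2)).
      assert (Rmin (eps / 2) (b / 2) <= eps / 2) by apply Rmin_l.
      assert (Rmin (eps / 2) (b / 2) <= b / 2) by apply Rmin_r.
      split; [apply Rmin_glb_lt; lra|lra]. }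
    destruct Hhi as (hi & G1 & G2 & G3).
    assert (A2 : 0 < F hi) by (rewrite <- F0 at 1; apply Fi; trivial; lra).
    assert (HA := filter_and _ _ (HL 0 HT) (locally_lt _ _ A2)).
    apply filter_imp with (2 := HA); intros r (B1 & B2) B3.
    assert (0 <= th r) by (apply Hth; trivial; lra).
    assert (th r < hi) by (apply (Hc r hi); trivial; lra).
    change (Rabs (th r - 0) < eps); apply Rabs_def1; lra.
Qed.

(* With [x = P th], [P' ^ 2 = r P] and [th' = sqrt (h (P th))] one gets
   [x' ^ 2 = r x * h x]; half the derivative of the right side is then [rhs]. *)
Lemma quadrature_response (kappa xi V : R) (P p r r1 h h1 th : R -> R) (T : Rbar) :
  Rbar_lt 0 T ->
  (forall u, is_derive P u (p u)) ->
  (forall u, is_derive p u (r1 (P u) / 2)) ->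
  (forall u, p u ^ 2 = r (P u)) ->
  P 0 = 0 -> p 0 = 0 ->
  th 0 = 0 ->
  filterlim th (at_right 0) (locally 0) ->
  (forall t, 0 < t -> Rbar_lt t T -> is_derive th t (sqrt (h (P (th t))))) ->
  (forall t, 0 <= t -> Rbar_lt t T -> let x := P (th t) in
     x < xi + 1 /\ 0 < h x /\ is_derive h x (h1 x) /\
     rhs kappa xi V x = r1 x / 2 * h x + r x * h1 x / 2) ->
  is_response kappa xi V T (fun t => P (th t)).
Proof.
  intros HT dP dp Ep P0 p0 th0 thr thd dom.
  assert (thc := right_ext_continuous_0 _ _ thr).
  assert (thp : forall t, 0 < t -> right_ext th 0 t = th t)
    by (intros; apply right_ext_pos; assumption).
  assert (th00 : right_ext th 0 0 = 0) by (apply right_ext_0; lra).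
  (* The factor [p] carries the sign of the velocity, and its derivative is known separately, so
     nothing is divided by [p] at a turning point. *)
  exists (fun t => p (th t) * sqrt (h (P (th t)))).
  split; [rewrite th0; exact P0|].
  split; [rewrite th0, p0; ring|].
  split; [intros t H1 H2; apply dom; assumption|].
  split; [|split].
  - intros t H1 H2; destruct (dom t (Rlt_le _ _ H1) H2) as (_ & Hh & dh & Er).
    assert (dth := thd t H1 H2).
    set (x := P (th t)) in *.
    assert (S0 : 0 < sqrt (h x)) by (apply sqrt_lt_R0, Hh).
    assert (dx : is_derive (fun t => P (th t)) t (p (th t) * sqrt (h x))).
    { rewrite Rmult_comm; apply (is_derive_comp P th); [apply dP|exact dth]. }
    split; [exact dx|].
    replace (rhs kappa xi V x) with
      (r1 x / 2 * sqrt (h x) * sqrt (h x)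
       + p (th t) * (p (th t) * sqrt (h x) * h1 x / (2 * sqrt (h x)))).
    + apply (is_derive_mult (fun t => p (th t)) (fun t => sqrt (h (P (th t)))));
        [| |intros; apply Rmult_comm].
      * rewrite Rmult_comm; apply (is_derive_comp p th); [apply dp|exact dth].
      * apply (is_derive_sqrt (fun t => h (P (th t)))); [|exact Hh].
        apply (is_derive_comp h (fun t => P (th t))); [exact dh|exact dx].
    + rewrite Er, <- (Ep (th t) : p (th t) ^ 2 = r x).
      transitivity (r1 x / 2 * (sqrt (h x) * sqrt (h x)) + p (th t) ^ 2 * h1 x / 2);
        [field; lra|rewrite sqrt_sqrt by lra; reflexivity].
  - apply filterlim_right with (fun t => P (right_ext th 0 t)).
    + apply cpt_comp; [|exact thc]; exact (is_derive_cpt _ _ _ (dP _)).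
    + apply filter_forall; intros t Ht; rewrite thp by exact Ht; reflexivity.
    + rewrite th00; exact P0.
  - apply filterlim_right with
      (fun t => p (right_ext th 0 t) * sqrt (h (P (right_ext th 0 t)))).
    + destruct (dom 0 (Rle_refl 0) HT) as (_ & Hh & dh & _).
      rewrite th0 in Hh, dh.
      apply cpt_mult.
      * apply cpt_comp; [|exact thc]; exact (is_derive_cpt _ _ _ (dp _)).
      * apply (cpt_comp (fun t => h (P (right_ext th 0 t))) sqrt).
        -- apply sqrt_continuity_pt; rewrite th00; exact Hh.
        -- apply (cpt_comp (fun t => P (right_ext th 0 t)) h).
           ++ rewrite th00; exact (is_derive_cpt _ _ _ dh).
           ++ apply cpt_comp; [|exact thc]; exact (is_derive_cpt _ _ _ (dP _)).
    + apply filter_forall; intros t Ht; rewrite thp by exact Ht; reflexivity.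
    + rewrite th00, p0; ring.
Qed.

Lemma clock_onto (g : R -> R) (c : R) : continuity g -> 0 < c -> (forall u, c <= g u) ->
  forall t, 0 <= t -> exists u, 0 <= u /\ clock g u = t.
Proof.
  intros Hg Hc Hm t Ht.
  assert (F0 := clock_0 g).
  assert (B : 0 <= t / c) by (apply Rdiv_le_0_compat; lra).
  assert (Ft : t <= clock g (t / c)).
  { destruct B as [B|B].
    - destruct (MVT_cor2 (clock g) g 0 (t / c) B) as (d & E & Hd).
      { intros d _; apply is_derive_Reals, clock_derive, Hg. }
      rewrite F0, !Rminus_0_r in E; rewrite E.
      replace t with (c * (t / c)) at 1 by (field; lra).
      apply Rmult_le_compat_r; [lra|apply Hm].
    - rewrite <- B, F0; replace t with (t / c * c) by (field; lra); rewrite <- B; lra. }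
  destruct (IVT_gen (clock g) 0 (t / c) t) as [u [Hu Eu]].
  - apply clock_continuity, Hg.
  - rewrite F0, Rmin_left, Rmax_right; lra.
  - rewrite Rmin_left in Hu by exact B; exists u; split; [lra|exact Eu].
Qed.

(** * The three regimes *)

Lemma derive_zero_const (f : R -> R) : (forall u, is_derive f u 0) -> forall a b, f a = f b.
Proof.
  intros Hf a b.
  destruct (MVT_gen f a b (fun _ => 0)) as (c & _ & E).
  - intros; apply Hf.
  - intros u _; exact (is_derive_cpt _ _ _ (Hf u)).
  - lra.
Qed.

Lemma inv_sqrt_continuous (h P : R -> R) (u : R) :
  continuity_pt h (P u) -> continuity_pt P u -> 0 < h (P u) ->
  continuity_pt (fun u => / sqrt (h (P u))) u.
Proof.
  intros Hh HP H0; apply cpt_inv; [|assert (H := sqrt_lt_R0 _ H0); lra].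
  apply (cpt_comp (fun u => h (P u)) sqrt); [apply sqrt_continuity_pt; exact H0|].
  apply cpt_comp; assumption.
Qed.

(** Compactness bounds [h] above on the closed interval. Positivity is asked only at the point
    considered, because at threshold it is known only short of the endpoint. *)
Lemma inv_sqrt_lower_bound (h : R -> R) (m : R) : 0 <= m ->
  (forall x, 0 <= x <= m -> continuity_pt h x) -> 0 < h 0 ->
  exists c, 0 < c /\ forall x, 0 <= x <= m -> 0 < h x -> c <= / sqrt (h x).
Proof.
  intros Hm Hc H0; destruct (continuity_ab_maj h 0 m Hm Hc) as [M [HM BM]].
  assert (PM : 0 < h M) by (apply Rlt_le_trans with (1 := H0), HM; lra).
  exists (/ sqrt (h M)); split; [apply Rinv_0_lt_compat, sqrt_lt_R0, PM|].
  intros x Hx Px; apply Rinv_le_contravar; [apply sqrt_lt_R0, Px|].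
  apply sqrt_le_1_alt, HM, Hx.
Qed.

(** The phase increases forever while [X * sin u ^ 2] rises up to [PI / 2] and falls up to [PI]. As
    [g] depends on [u] only through [sin u ^ 2], the symmetries of [sin] pass to the clock and then
    to the response. *)
Lemma periodic_response (xi k V : R) : 0 <= xi -> srange xi k V ->
  exists (ts : R) (x : R -> R),
    0 < ts /\ is_response k xi V p_infty x /\
    (forall t1 t2, 0 <= t1 -> t1 < t2 -> t2 <= ts -> x t1 < x t2) /\
    x ts = peak xi k V /\
    (forall t, 0 <= t -> x t <= peak xi k V) /\
    (forall s, 0 <= s <= ts -> x (ts + s) = x (ts - s)) /\
    (forall t, 0 <= t -> x (t + 2 * ts) = x t).
Proof.
  intros Hxi HS; assert (Hk := proj1 HS); destruct (peak_spec xi k V Hxi HS) as [B E].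
  assert (B' := xDpi_bounds xi k Hxi Hk); assert (PX := wslope_peak_pos xi k V Hxi HS).
  set (X := peak xi k V) in *.
  (* Here [V^2 - well x = (X - x) * wslope x X], and [P'^2 = 4 x (X - x)] takes both zeros out of
     the energy equation. *)
  set (h x := wslope xi k x X / (4 * (xi + 1) * (xi + 1 - x))).
  set (h1 x := (xi + 1) * (-1 + k / 2 * ((xi + 1) * (2 * x + X)
                - (3 * x ^ 2 + 2 * x * X + X ^ 2))) / (4 * (xi + 1) * (xi + 1 - x))
               + wslope xi k x X / (4 * (xi + 1) * (xi + 1 - x) ^ 2)).
  assert (hpos : forall x, 0 <= x <= X -> 0 < h x).
  { intros x Hx; apply Rdiv_lt_0_compat; [|apply Rmult_lt_0_compat; lra].
    destruct (Rlt_dec x X) as [L|L]; [|replace x with X by lra; exact PX].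
    assert (W := well_increasing xi k x X Hxi Hk L ltac:(lra)).
    assert (W2 := wslope_spec xi k x X).
    apply (Rmult_lt_reg_l (X - x)); lra. }
  assert (hd : forall x, x < xi + 1 -> is_derive h x (h1 x)).
  { intros x Hx; unfold h, h1, wslope; auto_derive; [|field; lra].
    apply Rgt_not_eq, Rmult_lt_0_compat; lra. }
  set (P u := X * sin u ^ 2).
  assert (PB : forall u, 0 <= P u <= X).
  { intros u; unfold P; assert (S := sin2_cos2 u); unfold Rsqr in S.
    assert (C := pow2_ge_0 (cos u)); assert (C2 := pow2_ge_0 (sin u)).
    split; [apply Rmult_le_pos; lra|].
    rewrite <- (Rmult_1_r X) at 2; apply Rmult_le_compat_l; lra. }
  assert (Pc : continuity P).
  { intros u; unfold P; cont; apply continuity_sin. }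
  set (g u := / sqrt (h (P u))).
  assert (gc : continuity g).
  { intros u; apply inv_sqrt_continuous; [|apply Pc|apply hpos, PB].
    apply (is_derive_cpt _ _ (h1 (P u))), hd; specialize (PB u); lra. }
  destruct (inv_sqrt_lower_bound h X) as (c & Hc & Hcb); [lra| |apply hpos; lra|].
  { intros x Hx; apply (is_derive_cpt _ _ (h1 x)), hd; lra. }
  assert (gpos : forall u, 0 < g u)
    by (intros u; apply Rlt_le_trans with c; [exact Hc|apply Hcb; [apply PB|apply hpos, PB]]).
  destruct (clock_inverse g p_infty p_infty gc) as (th & th0 & thF & thC & thd & thr).
  { intros; apply gpos. }
  { exact I. }
  { intros t Ht _.
    destruct (clock_onto g c gc Hc) with (t := t) as (u & Hu & Eu); trivial.
    - intros u; apply Hcb; [apply PB|apply hpos, PB].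
    - exists u; repeat split; trivial. }
  set (ts := clock g (PI / 2)).
  assert (pi0 := PI_RGT_0).
  assert (gi : forall u w, 0 <= u -> u < w -> clock g u < clock g w)
    by (intros; apply (clock_increasing g p_infty gc (fun u _ _ => gpos u)); trivial; exact I).
  assert (ts0 : 0 < ts) by (rewrite <- (clock_0 g); apply gi; lra).
  assert (thE : forall t u, 0 <= t -> 0 <= u -> clock g u = t -> th t = u)
    by (intros t u H1 H2; apply thC; trivial; exact I).
  assert (thm : forall t1 t2, 0 <= t1 -> t1 < t2 -> th t1 < th t2).
  { intros t1 t2 H1 H2; destruct (thF t1 H1 I) as (Q1 & _ & Q2).
    apply (thC t2 (th t1)); try exact I; lra. }
  assert (ths : th ts = PI / 2) by (apply thE; [lra|lra|reflexivity]).
  (* The left side has zero derivative because [g (PI - u) = g u]; its value is read off at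
     [PI / 2]. *)
  assert (refl : forall u, clock g (PI - u) + clock g u = 2 * ts).
  { intros u; transitivity (clock g (PI - PI / 2) + clock g (PI / 2)).
    - apply (derive_zero_const (fun u => clock g (PI - u) + clock g u)); intros w.
      replace 0 with (- 1 * g (PI - w) + g w).
      + apply @is_derive_plus; [|apply clock_derive, gc].
        apply (is_derive_comp (clock g) (fun w => PI - w)); [apply clock_derive, gc|].
        auto_derive; [trivial|ring].
      + unfold g, P; rewrite sin_PI_x; ring.
    - replace (PI - PI / 2) with (PI / 2) by field; unfold ts; ring. }
  assert (per : forall u, clock g (u + PI) = clock g u + 2 * ts).
  { intros u; enough (clock g (u + PI) - clock g u = 2 * ts) by lra.
    transitivity (clock g (0 + PI) - clock g 0).
    - apply (derive_zero_const (fun u => clock g (u + PI) - clock g u)); intros w.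
      replace 0 with (1 * g (w + PI) - g w).
      + apply @is_derive_minus; [|apply clock_derive, gc].
        apply (is_derive_comp (clock g) (fun w => w + PI)); [apply clock_derive, gc|].
        auto_derive; [trivial|ring].
      + unfold g, P; rewrite neg_sin; replace ((- sin w) ^ 2) with (sin w ^ 2) by ring; ring.
    - rewrite <- (refl 0), clock_0; replace (0 + PI) with (PI - 0) by ring; ring. }
  exists ts, (fun t => P (th t)).
  split; [exact ts0|split; [|split; [|split; [|split; [|split]]]]].
  - apply (quadrature_response k xi V P (fun u => 2 * X * sin u * cos u)
      (fun x => 4 * x * (X - x)) (fun x => 4 * X - 8 * x) h h1); trivial; try exact I.
    + intros u; unfold P; auto_derive; [trivial|ring].
    + intros u; unfold P; auto_derive; [trivial|].
      assert (S := sin2_cos2 u); unfold Rsqr in S.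
      replace ((4 * X - 8 * (X * sin u ^ 2)) / 2)
        with (2 * X * (sin u * sin u + cos u * cos u) - 4 * X * sin u ^ 2)
        by (rewrite S; field).
      ring.
    + intros u; unfold P; assert (S := sin2_cos2 u); unfold Rsqr in S.
      replace (X - X * sin u ^ 2)
        with (X * (sin u * sin u + cos u * cos u) - X * sin u ^ 2) by (rewrite S; ring).
      ring.
    + unfold P; rewrite sin_0; ring.
    + rewrite sin_0; ring.
    + intros t Ht _; specialize (thd t Ht I); unfold g in thd; rewrite Rinv_inv in thd.
      exact thd.
    + intros t _ _ x; assert (PBx : 0 <= x <= X) by apply PB.
      split; [lra|split; [apply hpos, PBx|split; [apply hd; lra|]]].
      unfold rhs; rewrite <- E; unfold h, h1, wslope, well; field; lra.
  - intros t1 t2 H1 H12 H2; assert (M := thm t1 t2 H1 H12).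
    destruct (thF t1 H1 I) as (Q1 & _).
    assert (Q2 : th t2 <= PI / 2).
    { rewrite <- ths; destruct H2 as [H2| ->]; [|lra].
      apply Rlt_le, thm; lra. }
    assert (S1 : sin (th t1) < sin (th t2)) by (apply sin_increasing_1; lra).
    assert (S0 : 0 <= sin (th t1)) by (apply sin_ge_0; lra).
    unfold P; apply Rmult_lt_compat_l; [lra|nra].
  - unfold P; rewrite ths, sin_PI2; ring.
  - intros t _; apply PB.
  - intros s Hs; replace (th (ts + s)) with (PI - th (ts - s)).
    + unfold P; rewrite sin_PI_x; reflexivity.
    + destruct (thF (ts - s) ltac:(lra) I) as (_ & _ & Q).
      symmetry; apply thE; [lra| |specialize (refl (th (ts - s))); lra].
      assert (th (ts - s) <= PI / 2); [|lra].
      rewrite <- ths; destruct (Req_dec s 0) as [->|N]; [rewrite Rminus_0_r; lra|].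
      apply Rlt_le, thm; lra.
  - intros t Ht; destruct (thF t Ht I) as (Q1 & _ & Q).
    rewrite (thE (t + 2 * ts) (th t + PI)); [|lra|lra|rewrite per; lra].
    unfold P; rewrite neg_sin; ring.
Qed.

(** Now [V^2] exceeds the maximum of [well], so there is no turning point, and only the zero of the
    speed at the start is removed by [x = u^2]. The contact time is finite as the integral of a
    continuous function over [[0, 1]]. *)
Lemma contact_response (xi k V : R) : 0 <= xi -> krange xi k -> VDpi xi k (xDpi xi k) < V ->
  exists (tc : R) (x : R -> R),
    0 < tc /\ is_response k xi V tc x /\
    (forall t, 0 <= t < tc -> x t < 1) /\
    filterlim x (at_left tc) (locally 1).
Proof.
  intros Hxi Hk HV.
  assert (gap : forall x, 0 < V ^ 2 - well xi k x).
  { intros x; assert (P := VDpi_pos xi k Hxi Hk); assert (S := VDpi_sqr xi k Hxi Hk).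
    assert (W := well_max_le xi k x Hxi Hk).
    assert (VDpi xi k (xDpi xi k) ^ 2 < V ^ 2) by nra; lra. }
  set (h x := (V ^ 2 - well xi k x) / (4 * (xi + 1) * (xi + 1 - x))).
  set (h1 x := ((xi + 1) * dpi_cubic k xi x * (xi + 1 - x) + (V ^ 2 - well xi k x))
               / (4 * (xi + 1) * (xi + 1 - x) ^ 2)).
  assert (hpos : forall x, x < xi + 1 -> 0 < h x).
  { intros x Hx; apply Rdiv_lt_0_compat; [apply gap|apply Rmult_lt_0_compat; lra]. }
  assert (hd : forall x, x < xi + 1 -> is_derive h x (h1 x)).
  { intros x Hx; unfold h, h1, well, dpi_cubic; auto_derive; [|field; lra].
    apply Rgt_not_eq, Rmult_lt_0_compat; lra. }
  (* [Rabs] keeps the radicand nonnegative, hence [g] continuous, past the singularity;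
     if [xi = 0] then [g 1 = 0]. *)
  set (g u := sqrt (4 * (xi + 1) * Rabs (xi + 1 - u ^ 2) * / (V ^ 2 - well xi k (u ^ 2)))).
  assert (gE : forall u, u ^ 2 < xi + 1 -> g u = / sqrt (h (u ^ 2))).
  { intros u Hu; unfold g, h; rewrite <- sqrt_inv; f_equal; rewrite Rabs_pos_eq by lra.
    field; specialize (gap (u ^ 2)); lra. }
  assert (gc : continuity g).
  { intros u; specialize (gap (u ^ 2)).
    apply (cpt_comp (fun u => 4 * (xi + 1) * Rabs (xi + 1 - u ^ 2)
                              * / (V ^ 2 - well xi k (u ^ 2))) sqrt).
    - apply continuity_pt_sqrt; apply Rmult_le_pos.
      + apply Rmult_le_pos; [lra|apply Rabs_pos].
      + apply Rlt_le, Rinv_0_lt_compat, gap.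
    - assert (Rc := cpt_comp (fun u => xi + 1 - u ^ 2) Rabs u (Rcontinuity_abs _)
                      ltac:(cont)).
      unfold well, Rdiv; cont; exact (Rgt_not_eq _ _ gap). }
  assert (sq : forall u, 0 <= u -> u < 1 -> u ^ 2 < 1) by (intros; nra).
  assert (gpos : forall u : R, 0 <= u -> Rbar_lt u 1 -> 0 < g u).
  { intros u Hu Hu1; specialize (sq u Hu Hu1); rewrite gE by lra.
    apply Rinv_0_lt_compat, sqrt_lt_R0, hpos; lra. }
  assert (gi : forall u w : R, 0 <= u -> u < w -> w <= 1 -> clock g u < clock g w)
    by (intros u w Hu Huw Hw; exact (clock_increasing g 1 gc gpos u w Hu Huw Hw)).
  set (tc := clock g 1).
  assert (tc0 : 0 < tc) by (rewrite <- (clock_0 g); apply gi; lra).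
  destruct (clock_inverse g 1 tc gc gpos tc0) as (th & th0 & thF & thC & thd & thr).
  { intros t Ht Htc; simpl in Htc.
    destruct (IVT_gen (clock g) 0 1 t) as [u [Hu Eu]].
    - apply clock_continuity, gc.
    - rewrite clock_0; fold tc; rewrite Rmin_left, Rmax_right; lra.
    - rewrite Rmin_left, Rmax_right in Hu by lra; exists u; repeat split; [lra| |exact Eu].
      simpl; destruct (Req_dec u 1) as [->|]; [fold tc in Eu|]; lra. }
  assert (thB : forall t, 0 <= t < tc -> 0 <= th t < 1).
  { intros t [H1 H2]; destruct (thF t H1 H2) as (Q1 & Q2 & _); split; [exact Q1|exact Q2]. }
  exists tc, (fun t => th t ^ 2).
  split; [exact tc0|split; [|split]].
  - apply (quadrature_response k xi V (fun u => u ^ 2) (fun u => 2 * u)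
      (fun x => 4 * x) (fun _ => 4) h h1); trivial.
    + intros u; auto_derive; [trivial|ring].
    + intros u; auto_derive; [trivial|field].
    + intros u; ring.
    + ring.
    + ring.
    + intros t Ht Htc; specialize (thd t Ht Htc).
      destruct (thB t) as [B1 B2]; [split; [lra|exact Htc]|].
      specialize (sq _ B1 B2); rewrite gE, Rinv_inv in thd by lra; exact thd.
    + intros t Ht Htc x; destruct (thB t) as [B1 B2]; [split; [lra|exact Htc]|].
      assert (x < 1) by apply (sq _ B1 B2).
      split; [lra|split; [apply hpos; lra|split; [apply hd; lra|]]].
      unfold rhs, h, h1, well, dpi_cubic; field; lra.
  - intros t Ht; destruct (thB t Ht); apply sq; assumption.
  - apply filterlim_locally; intros eps; assert (Pe := cond_pos eps).
    set (lo := Rmax 0 (1 - eps / 2)).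
    assert (L1 : 0 <= lo) by apply Rmax_l.
    assert (L2 : 1 - eps / 2 <= lo) by apply Rmax_r.
    assert (L3 : lo < 1) by (apply Rmax_lub_lt; lra).
    assert (L4 : clock g lo < tc) by (apply gi; lra).
    unfold at_left, within.
    apply filter_imp with (2 := filter_and _ _ (locally_gt _ _ L4) (locally_gt _ _ tc0)).
    intros t [T1 T2] T3; destruct (thB t ltac:(lra)) as [B1 B2].
    assert (lo < th t) by (apply (thC t lo); simpl; lra).
    change (Rabs (th t ^ 2 - 1) < eps); apply Rabs_def1; nra.
Qed.

(** * The threshold case: approach to the unstable equilibrium *)

Lemma cubic_solved (xi k D : R) : dpi_cubic k xi D = 0 ->
  3 * (xi + 1) * D ^ 2 - 4 * D ^ 3 <> 0 ->
  k = (4 * D - 2 * (xi + 1)) / (3 * (xi + 1) * D ^ 2 - 4 * D ^ 3).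
Proof.
  intros H N; apply (Rmult_eq_reg_r (3 * (xi + 1) * D ^ 2 - 4 * D ^ 3)); [|exact N].
  unfold dpi_cubic in H.
  replace ((4 * D - 2 * (xi + 1)) / (3 * (xi + 1) * D ^ 2 - 4 * D ^ 3)
           * (3 * (xi + 1) * D ^ 2 - 4 * D ^ 3)) with (4 * D - 2 * (xi + 1)) by (field; exact N).
  lra.
Qed.

(* This is [tanh], with its value written so as to show the limit at infinity. *)
Definition th_exp (u : R) : R := 1 - 2 / (exp (2 * u) + 1).

Lemma th_exp_derive (u : R) : is_derive th_exp u (1 - th_exp u ^ 2).
Proof.
  assert (P := exp_pos (2 * u)); unfold th_exp; auto_derive; [lra|field; lra].
Qed.

Lemma th_exp_0 : th_exp 0 = 0.
Proof. unfold th_exp; rewrite Rmult_0_r, exp_0; field. Qed.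

Lemma th_exp_bounds (u : R) : 0 <= th_exp u ^ 2 < 1.
Proof.
  split; [apply pow2_ge_0|].
  assert (P := exp_pos (2 * u)).
  assert (A : 0 < 2 / (exp (2 * u) + 1)) by (apply Rdiv_lt_0_compat; lra).
  assert (B : 2 / (exp (2 * u) + 1) < 2).
  { apply (Rmult_lt_reg_r (exp (2 * u) + 1)); [lra|].
    replace (2 / (exp (2 * u) + 1) * (exp (2 * u) + 1)) with 2 by (field; lra); lra. }
  unfold th_exp; nra.
Qed.

(** The decay is exponential, but [exp (2 u) > 1 + 2 u] already gives a rate sufficient for the
    limit. *)
Lemma th_exp_tail (u : R) : 0 < u -> 1 - th_exp u ^ 2 < 2 / u.
Proof.
  intros Hu; assert (P := exp_ineq1 (2 * u) ltac:(lra)).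
  assert (A : 0 < 2 / (exp (2 * u) + 1)) by (apply Rdiv_lt_0_compat; lra).
  assert (B : 2 / (exp (2 * u) + 1) < / u).
  { apply (Rmult_lt_reg_r (exp (2 * u) + 1)); [lra|].
    replace (2 / (exp (2 * u) + 1) * (exp (2 * u) + 1)) with 2 by (field; lra).
    apply (Rmult_lt_reg_l u); [lra|].
    replace (u * (/ u * (exp (2 * u) + 1))) with (exp (2 * u) + 1) by (field; lra); lra. }
  unfold th_exp; set (q := 2 / (exp (2 * u) + 1)) in *.
  change (2 / u) with (2 * / u); nra.
Qed.

(** Taylor expansion of the quartic [well xi k D - well xi k x] at the critical point [D], with its
    double zero divided out. *)
Definition well_quot (xi k D x : R) : R :=
  (xi + 1) * (1 - k / 2 * (3 * (xi + 1) * D - 6 * D ^ 2)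
    - k / 2 * (xi + 1 - 4 * D) * (x - D) + k / 2 * (x - D) ^ 2).

Lemma well_quot_spec (xi k D x : R) : dpi_cubic k xi D = 0 ->
  well xi k D - well xi k x = (D - x) ^ 2 * well_quot xi k D x.
Proof.
  intros H.
  transitivity ((D - x) ^ 2 * well_quot xi k D x - (D - x) * (xi + 1) * dpi_cubic k xi D).
  - unfold well, well_quot, dpi_cubic; field.
  - rewrite H; ring.
Qed.

(** For [P = D * th_exp ^ 2] one has [P'^2 = 4 / D * P * (D - P)^2], which absorbs the double zero.
    The phase passes every finite value, whereas [P] stays below [D]: hence convergence without
    arrival. *)
Lemma threshold_response (xi k V : R) : 0 <= xi -> krange xi k -> V = VDpi xi k (xDpi xi k) ->
  exists x : R -> R,
    is_response k xi V p_infty x /\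
    (forall t, 0 <= t -> x t < xDpi xi k) /\
    filterlim x (Rbar_locally p_infty) (locally (xDpi xi k)).
Proof.
  intros Hxi Hk HV; assert (E := VDpi_sqr xi k Hxi Hk); rewrite <- HV in E.
  assert (B := xDpi_bounds xi k Hxi Hk); assert (Hroot := xDpi_root xi k Hxi Hk).
  assert (Hmax := fun x => well_max xi k x Hxi Hk).
  set (D := xDpi xi k) in *.
  set (h x := well_quot xi k D x * D / (4 * (xi + 1) * (xi + 1 - x))).
  set (h1 x := (xi + 1) * (- (k / 2 * (xi + 1 - 4 * D)) + k * (x - D)) * D
                 / (4 * (xi + 1) * (xi + 1 - x))
               + well_quot xi k D x * D / (4 * (xi + 1) * (xi + 1 - x) ^ 2)).
  assert (hpos : forall x, x < D -> 0 < h x).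
  { intros x Hx; assert (W := well_quot_spec xi k D x Hroot); specialize (Hmax x ltac:(lra)).
    assert (0 < (D - x) ^ 2) by (apply pow_lt; lra).
    apply Rdiv_lt_0_compat; [|apply Rmult_lt_0_compat; lra].
    apply Rmult_lt_0_compat; [|lra].
    apply (Rmult_lt_reg_l ((D - x) ^ 2)); lra. }
  assert (hd : forall x, x < xi + 1 -> is_derive h x (h1 x)).
  { intros x Hx; unfold h, h1, well_quot; auto_derive; [|field; lra].
    apply Rgt_not_eq, Rmult_lt_0_compat; lra. }
  set (P u := D * th_exp u ^ 2).
  assert (PB : forall u, 0 <= P u < D).
  { intros u; unfold P; destruct (th_exp_bounds u); split; [apply Rmult_le_pos; lra|].
    rewrite <- (Rmult_1_r D) at 2; apply Rmult_lt_compat_l; lra. }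
  assert (thc : continuity th_exp)
    by (intros u; exact (is_derive_cpt _ _ _ (th_exp_derive u))).
  assert (Pc : continuity P) by (intros u; apply cpt_mult; [apply cpt_const|apply cpt_pow, thc]).
  set (g u := / sqrt (h (P u))).
  assert (gc : continuity g).
  { intros u; apply inv_sqrt_continuous; [|apply Pc|apply hpos, PB].
    apply (is_derive_cpt _ _ (h1 (P u))), hd; specialize (PB u); lra. }
  destruct (inv_sqrt_lower_bound h D) as (c & Hc & Hcb); [lra| |apply hpos; lra|].
  { intros x Hx; apply (is_derive_cpt _ _ (h1 x)), hd; lra. }
  assert (gb : forall u, c <= g u).
  { intros u; apply Hcb; [specialize (PB u); lra|apply hpos, PB]. }
  destruct (clock_inverse g p_infty p_infty gc) as (th & th0 & thF & thC & thd & thr).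
  { intros; apply Rlt_le_trans with c; trivial. }
  { exact I. }
  { intros t Ht _; destruct (clock_onto g c gc Hc gb t Ht) as (u & Hu & Eu).
    exists u; repeat split; trivial. }
  exists (fun t => P (th t)).
  split; [|split; [intros t _; apply PB|]].
  - apply (quadrature_response k xi V P (fun u => 2 * D * th_exp u * (1 - th_exp u ^ 2))
      (fun x => 4 / D * x * (D - x) ^ 2)
      (fun x => 4 / D * ((D - x) ^ 2 - 2 * x * (D - x))) h h1); trivial; try exact I.
    + intros u; assert (T := th_exp_derive u); unfold P; auto_derive; [eexists; exact T|].
      replace (Derive (fun x => th_exp x) u) with (1 - th_exp u ^ 2)
        by (symmetry; apply is_derive_unique, T).
      ring.
    + intros u; assert (T := th_exp_derive u); unfold P; auto_derive;
        [repeat split; eexists; exact T|].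
      replace (Derive (fun x => th_exp x) u) with (1 - th_exp u ^ 2)
        by (symmetry; apply is_derive_unique, T).
      field; lra.
    + intros u; unfold P; field; lra.
    + unfold P; rewrite th_exp_0; ring.
    + rewrite th_exp_0; ring.
    + intros t Ht _; specialize (thd t Ht I); unfold g in thd; rewrite Rinv_inv in thd.
      exact thd.
    + intros t _ _ x; assert (PBx : 0 <= x < D) by apply PB.
      split; [lra|split; [apply hpos, PBx|split; [apply hd; lra|]]].
      assert (N : 0 < 3 * (xi + 1) * D ^ 2 - 4 * D ^ 3).
      { replace (3 * (xi + 1) * D ^ 2 - 4 * D ^ 3) with (D ^ 2 * (3 * (xi + 1) - 4 * D)) by ring.
        apply Rmult_lt_0_compat; [apply pow_lt|]; lra. }
      unfold rhs; rewrite E; unfold h, h1, well_quot, well.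
      (* The identity holds only modulo the cubic; eliminating [k] makes it a rational identity in
         [D], [x] and [xi]. *)
      rewrite (cubic_solved xi k D Hroot (Rgt_not_eq _ _ N)); field.
      repeat split; lra.
  - apply filterlim_locally; intros eps; assert (Pe := cond_pos eps).
    (* Beyond this phase the tail bound gives [D - P u < 2 D / u < eps]. *)
    set (u0 := 2 * D / eps).
    assert (Pu : 0 < u0) by (apply Rdiv_lt_0_compat; lra).
    exists (Rmax 0 (clock g u0)); intros t Ht.
    assert (T0 : 0 < t) by (apply Rle_lt_trans with (2 := Ht), Rmax_l).
    assert (T1 : clock g u0 < t) by (apply Rle_lt_trans with (2 := Ht), Rmax_r).
    assert (T2 : u0 < th t) by (apply (thC t u0); try exact I; lra).
    assert (T3 : 0 < th t) by lra.
    assert (Q := th_exp_tail (th t) T3).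
    assert (Q2 : 2 / th t < eps / D).
    { unfold u0 in T2; apply (Rmult_lt_reg_r (th t)); [exact T3|].
      replace (2 / th t * th t) with (2 * D / eps * (eps / D)) by (field; lra).
      rewrite (Rmult_comm (eps / D)); apply Rmult_lt_compat_r; [|exact T2].
      apply Rdiv_lt_0_compat; lra. }
    assert (Q3 : D * (1 - th_exp (th t) ^ 2) < D * (eps / D)) by (apply Rmult_lt_compat_l; lra).
    replace (D * (eps / D)) with (pos eps) in Q3 by (field; lra).
    assert (PBt := PB (th t)).
    change (Rabs (P (th t) - D) < eps); unfold P in *; apply Rabs_def1; lra.
Qed.

Theorem theorem2 (xi : R) (Hxi : 0 <= xi) :
  exists (xD : R -> R) (Xs : R -> R -> R),
    (* x*_Dpi: the unique real root of the cubic, lying in (0, xi+1) *)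
    (forall k, 0 < k < 16 / (3 * (xi + 1) ^ 2) ->
       (forall x0, dpi_cubic k xi x0 = 0 <-> x0 = xD k) /\
       0 < xD k < xi + 1) /\
    (* smooth dependence, strict monotonicity and limits as kappa -> 0 *)
    smooth1 (fun k => 0 < k < 16 / (3 * (xi + 1) ^ 2)) xD /\
    smooth1 (fun k => 0 < k < 16 / (3 * (xi + 1) ^ 2))
            (fun k => VDpi xi k (xD k)) /\
    (forall k1 k2, 0 < k1 -> k1 < k2 -> k2 < 16 / (3 * (xi + 1) ^ 2) ->
       xD k1 < xD k2 /\ VDpi xi k1 (xD k1) < VDpi xi k2 (xD k2)) /\
    filterlim xD (at_right 0) (locally ((xi + 1) / 2)) /\
    filterlim (fun k => VDpi xi k (xD k)) (at_right 0)
              (locally ((xi + 1) * sqrt (xi + 1) / 2)) /\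
    (* x*_s as a function of (kappa, V) on the range V < V*_Dpi *)
    smooth2 (fun k V => 0 < k < 16 / (3 * (xi + 1) ^ 2) /\
                        0 < V < VDpi xi k (xD k)) Xs /\
    (forall k1 k2 V, 0 < k1 -> k1 < k2 -> k2 < 16 / (3 * (xi + 1) ^ 2) ->
       0 < V < VDpi xi k1 (xD k1) -> Xs k2 V < Xs k1 V) /\
    (forall k V1 V2, 0 < k < 16 / (3 * (xi + 1) ^ 2) ->
       0 < V1 -> V1 < V2 -> V2 < VDpi xi k (xD k) -> Xs k V1 < Xs k V2) /\
    (forall k V, 0 < k < 16 / (3 * (xi + 1) ^ 2) -> 0 < V ->
      (* (1) periodic response *)
      (V < VDpi xi k (xD k) ->
         exists (ts : R) (x : R -> R),
           0 < ts /\
           is_response k xi V p_infty x /\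
           (forall T y, is_response k xi V T y ->
              forall t, 0 <= t -> Rbar_lt t T -> y t = x t) /\
           (forall t1 t2, 0 <= t1 -> t1 < t2 -> t2 <= ts -> x t1 < x t2) /\
           x ts = Xs k V /\
           (forall t, 0 <= t -> x t <= Xs k V) /\
           (forall s, 0 <= s <= ts -> x (ts + s) = x (ts - s)) /\
           (forall t, 0 <= t -> x (t + 2 * ts) = x t) /\
           (V < (xi + 1) * sqrt (xi + 1) / 2 ->
              Xs k V < (xi + 1) / 2
                       - / 2 * sqrt ((xi + 1) ^ 2 - 4 * V ^ 2 / (xi + 1)))) /\
      (* (2) contact in finite time *)
      (VDpi xi k (xD k) < V ->
         exists (tc : R) (x : R -> R),
           0 < tc /\
           is_response k xi V (Finite tc) x /\
           (forall T y, is_response k xi V T y ->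
              forall t, 0 <= t -> Rbar_lt t T -> t < tc -> y t = x t) /\
           (forall t, 0 <= t < tc -> x t < 1) /\
           filterlim x (at_left tc) (locally 1)) /\
      (* (3) threshold case *)
      (V = VDpi xi k (xD k) ->
         exists x : R -> R,
           is_response k xi V p_infty x /\
           (forall T y, is_response k xi V T y ->
              forall t, 0 <= t -> Rbar_lt t T -> y t = x t) /\
           (forall t, 0 <= t -> x t < xD k) /\
           filterlim x (Rbar_locally p_infty) (locally (xD k)))).
Proof.
  exists (xDpi xi), (peak xi).
  assert (kr : forall k1 k2, 0 < k1 -> k1 < k2 -> k2 < 16 / (3 * (xi + 1) ^ 2) ->
            krange xi k1 /\ krange xi k2) by (unfold krange; intros; lra).
  assert (HU := krange_open xi).
  split; [|split; [|split; [|split; [|split; [|split; [|split; [|split; [|split]]]]]]]].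
  - intros k Hk; split; [intros x0; exact (xDpi_unique xi k x0 Hxi Hk)|].
    assert (B := xDpi_bounds xi k Hxi Hk); lra.
  - intros n k Hk.
    exact (C2_ex_derive_n n _ (fun k _ => xDpi xi k) k 0 HU (xDpi_smooth xi Hxi n) Hk).
  - intros n k Hk.
    exact (C2_ex_derive_n n _ (fun k _ => VDpi xi k (xDpi xi k)) k 0 HU
             (VDpi_smooth xi Hxi n) Hk).
  - intros k1 k2 H1 H12 H2; destruct (kr k1 k2 H1 H12 H2).
    split; [apply xDpi_increasing|apply VDpi_increasing]; trivial.
  - exact (xDpi_lim_0 xi Hxi).
  - exact (VDpi_lim_0 xi Hxi).
  - exact (peak_smooth xi Hxi).
  - intros k1 k2 V H1 H12 H2 HV; destruct (kr k1 k2 H1 H12 H2).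
    apply peak_decreasing_k; trivial.
  - intros k V1 V2 Hk; exact (peak_increasing_V xi k V1 V2 Hxi Hk).
  - intros k V Hk HV; split; [|split].
    + intros HD; assert (HS : srange xi k V) by (split; [exact Hk|split; assumption]).
      destruct (periodic_response xi k V Hxi HS) as (ts & x & H1 & H2 & H3 & H4 & H5 & H6 & H7).
      exists ts, x; repeat (split; [assumption|]); split; [|repeat (split; [assumption|])].
      * intros T y Hy t Ht HT; exact (response_unique k xi V p_infty T x y H2 Hy t Ht I HT).
      * exact (peak_linear_bound xi k V Hxi HS).
    + intros HD.
      destruct (contact_response xi k V Hxi Hk HD) as (tc & x & H1 & H2 & H3 & H4).
      exists tc, x; repeat (split; [assumption|]); split; [|split; assumption].
      intros T y Hy t Ht HT Htc; exact (response_unique k xi V tc T x y H2 Hy t Ht Htc HT).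
    + intros HD.
      destruct (threshold_response xi k V Hxi Hk HD) as (x & H1 & H2 & H3).
      exists x; split; [assumption|]; split; [|split; assumption].
      intros T y Hy t Ht HT; exact (response_unique k xi V p_infty T x y H1 Hy t Ht I HT).
Qed.
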